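(* For every integer $i\ge 1$, the straight-line drawing $\Gamma'_i$ (defined in the context) of the plane graph $\mathfrak H_i$ is a convex angle-monotone drawing of $\mathfrak H_i$ on a $(2i+3)\times(2i+3)$ grid.
   Context: **Drawings.** A straight-line drawing of a graph maps each vertex to a point of $\mathbb R^2$ and each edge to the straight-line segment between its end-points. It is planar if no two edges cross. It is convex if it is planar and every face (including the outer one) is delimited by a convex polygon, where angles equal to $\pi$ at vertices of the polygon are allowed. A grid drawing maps each vertex to a point with integer coordinates; its width (resp. height) is the number of grid columns (resp. rows) intersecting it. A drawing lies on a $W\times H$ grid if it is a grid drawing with width $W$ and height $H$. A drawing of a plane graph is meant to respect its plane embedding and outer face. **Angle-monotone drawings.** The slope of an edge traversed from $u$ to $v$ is the angle in $[0,2\pi)$ by which a rightward ray from $u$ must be rotated counter-clockwise to overlap with the segment from $u$ to $v$. A path $(w_1,\dots,w_k)$ in a straight-line drawing is $\beta$-monotone if, for each $i$, the edge $(w_i,w_{i+1})$ lies in the closed wedge of angle $\pi/2$ with apex $w_i$ bisected by the ray from $w_i$ with slope $\beta$. A straight-line drawing is angle-monotone if for every pair of vertices $u,v$ there is, for some angle $\beta$, a $\beta$-monotone path from $u$ to $v$ in the graph. **The graphs $\mathfrak H_i$.** The plane graph $\mathfrak H_1$ consists of a cycle $(x_2,z_1,y_2,x_1,z_2,y_1)$, which bounds the outer face, and of a vertex $x_0$ embedded inside this cycle and adjacent to $x_1,y_1,z_1$. For $i\ge 2$, $\mathfrak H_i$ is obtained from $\mathfrak H_{i-1}$ by embedding in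 its outer face three new vertices $x_{i+1},y_{i+1},z_{i+1}$ and the edges of the cycle $(x_{i+1},z_i,y_{i+1},x_i,z_{i+1},y_i)$, which bounds the outer face of $\mathfrak H_i$. **The drawing $\Gamma_i$.** Put $t_1=x_1$, $l_1=z_1$, $r_1=y_1$. For $j\ge1$, let $t_{j+1}$ be $y_{j+1}$, $z_{j+1}$, or $x_{j+1}$ according to whether $t_j$ is $x_j$, $y_j$, or $z_j$, respectively; define $l_{j+1}$ from $l_j$ and $r_{j+1}$ from $r_j$ by the same rule. Thus $\{t_j,l_j,r_j\}=\{x_j,y_j,z_j\}$ for every $j$. In the straight-line drawing $\Gamma_i$ of $\mathfrak H_i$, the vertex $x_0$ is at $(0,0)$ and, for $1\le j\le i+1$, the vertices $t_j,l_j,r_j$ are at $(0,j)$, $(-j,-j)$, $(j,-j)$, respectively. **The drawing $\Gamma'_i$.** It is obtained from $\Gamma_i$ by moving $r_i$ one unit to the right and one unit down, moving $r_{i+1}$ and $l_{i+1}$ one unit to the right, and moving $t_{i+1}$ one unit to the left (all other vertices stay in place and edges are drawn straight). *)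

(* Defs.v *)
From HB Require Import structures.
From mathcomp Require Import all_boot all_order all_algebra.
From mathcomp Require Import all_classical all_reals all_analysis.

Set Implicit Arguments.
Unset Strict Implicit.
Unset Printing Implicit Defensive.

Import Order.TTheory GRing.Theory Num.Theory.
Import numFieldNormedType.Exports.

Local Open Scope classical_set_scope.
Local Open Scope card_scope.
Local Open Scope ring_scope.

(** * Plane geometry *)

Section Plane.
Context {R : realType}.
Implicit Types (p q : R * R) (P : seq (R * R)) (A D F : set (R * R)).

Definition segment p q : set (R * R) :=
  [set p + t *: (q - p) | t in `[0, 1]].

(* The closed curve through the points of [P], in cyclic order. *)
Definition polygon P : set (R * R) :=
  [set a | exists2 s, s \in zip P (rot 1 P) & segment s.1 s.2 a].

Definition frontier A : set (R * R) := closure A `\` A°.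

(* The polygon bounds a convex region with nonempty interior. Consecutive
   collinear sides, that is, angles equal to pi, are allowed. *)
Definition convex_polygon P : Prop :=
  exists K : set (convex_lmodType (R * R)%type),
    [/\ convex_set K, compact (K : set (R * R)),
        (K : set (R * R))° !=set0 & polygon P = frontier K].

(* The closed wedge of angle pi/2 with apex [p], bisected by the ray of slope
   [beta]: it is the union of the rays from [p] whose slopes differ from [beta]
   by at most pi/4. *)
Definition wedge (beta : R) p : set (R * R) :=
  [set a | exists rho theta : R,
     [/\ 0 <= rho, beta - pi / 4 <= theta <= beta + pi / 4 &
         a = p + rho *: (cos theta, sin theta)]].

Definition monotone_path (beta : R) P : Prop :=
  forall s, s \in zip P (behead P) -> segment s.1 s.2 `<=` wedge beta s.1.

(* The faces of a drawing that covers the point set [D]. *)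
Definition is_face D F : Prop :=
  exists2 p, ~ D p & F = connected_component (~` D) p.

End Plane.

(** * Plane graphs and their straight-line drawings *)

(* The plane embedding is given by the facial cycles: the boundaries of the
   bounded faces, and the boundary of the outer face. Every edge is listed in
   [edges] in one of its two directions, and a facial cycle is listed up to
   rotation and reversal. *)
Record plane_graph (T : eqType) := PlaneGraph {
  vertices : seq T;
  edges : seq (T * T);
  inner_faces : seq (seq T);
  outer_face : seq T }.

Definition adj (T : eqType) (G : plane_graph T) : rel T :=
  fun u v => ((u, v) \in edges G) || ((v, u) \in edges G).

Section Drawings.
Context {R : realType} {T : eqType}.
Variables (G : plane_graph T) (pos : T -> R * R).

Definition drawing : set (R * R) :=
  [set p | exists2 v, v \in vertices G & p = pos v] `|`
  [set p | exists2 e, e \in edges G & segment (pos e.1) (pos e.2) p].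

Definition planar_drawing : Prop :=
  [/\ {in vertices G &, injective pos},
      {in vertices G & edges G, forall w e,
         segment (pos e.1) (pos e.2) (pos w) -> w \in [:: e.1; e.2]} &
      {in edges G &, forall e f, e <> f -> forall p,
         segment (pos e.1) (pos e.2) p -> segment (pos f.1) (pos f.2) p ->
         exists w, [/\ w \in [:: e.1; e.2], w \in [:: f.1; f.2] & p = pos w]}].

(* A face of a planar drawing that is delimited by a polygon is delimited by a
   cycle of the graph; by planarity, the polygon of such a cycle is simple. *)
Definition convex_drawing : Prop :=
  planar_drawing /\
  forall F, is_face drawing F ->
    exists c : seq T,
      [/\ ucycle (adj G) c, (2 < size c)%N,
          frontier F = polygon (map pos c) & convex_polygon (map pos c)].

(* The drawing is planar and its faces are those of the plane graph. *)
Definition respects_embedding : Prop :=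
  [/\ planar_drawing,
      {in inner_faces G, forall c, exists F,
         [/\ is_face drawing F, bounded_set F &
             frontier F = polygon (map pos c)]},
      exists F,
        [/\ is_face drawing F, ~ bounded_set F &
            frontier F = polygon (map pos (outer_face G))] &
      forall F, is_face drawing F ->
        (bounded_set F -> exists2 c, c \in inner_faces G &
                            frontier F = polygon (map pos c)) /\
        (~ bounded_set F -> frontier F = polygon (map pos (outer_face G)))].

Definition angle_monotone : Prop :=
  {in vertices G &, forall u v, exists (beta : R) (w : seq T),
     [/\ path (adj G) u w, uniq (u :: w), last u w = v &
         monotone_path beta (map pos (u :: w))]}.

Definition grid_drawing : Prop :=
  {in vertices G, forall v,
     ((pos v).1 \is a Num.int) && ((pos v).2 \is a Num.int)}.

(* The grid columns are the vertical lines with an integer abscissa; the grid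
   rows are the horizontal lines with an integer ordinate. *)
Definition columns : set int := [set k | exists2 p, drawing p & p.1 = k%:~R].
Definition rows : set int := [set k | exists2 p, drawing p & p.2 = k%:~R].

Definition on_grid (W H : nat) : Prop :=
  [/\ grid_drawing, columns #= `I_W & rows #= `I_H].

End Drawings.

(** * The plane graphs H_i *)

Inductive vertex := Vx of nat | Vy of nat | Vz of nat.

Definition vertex_code (v : vertex) : nat + (nat + nat) :=
  match v with Vx j => inl j | Vy j => inr (inl j) | Vz j => inr (inr j) end.
Definition vertex_decode (c : nat + (nat + nat)) : vertex :=
  match c with inl j => Vx j | inr (inl j) => Vy j | inr (inr j) => Vz j end.
Lemma vertex_codeK : cancel vertex_code vertex_decode.
Proof. by case. Qed.
HB.instance Definition _ := Equality.copy vertex (can_type vertex_codeK).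

Definition cycle_edges (T : Type) (c : seq T) : seq (T * T) := zip c (rot 1 c).

Definition outer_cycle (i : nat) : seq vertex :=
  [:: Vx i.+1; Vz i; Vy i.+1; Vx i; Vz i.+1; Vy i].

Definition graphH1 : plane_graph vertex := {|
  vertices := Vx 0 :: outer_cycle 1;
  edges := [:: (Vx 0, Vx 1); (Vx 0, Vy 1); (Vx 0, Vz 1)]
             ++ cycle_edges (outer_cycle 1);
  inner_faces := [:: [:: Vx 0; Vz 1; Vy 2; Vx 1];
                     [:: Vx 0; Vx 1; Vz 2; Vy 1];
                     [:: Vx 0; Vy 1; Vx 2; Vz 1]];
  outer_face := outer_cycle 1 |}.

(* From H_(i-1) to H_i. The outer cycles of these two graphs share the vertices
   x_i, y_i, z_i; between two consecutive shared vertices, the two cycles have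
   one private vertex each, and they enclose a new quadrilateral face there. *)
Definition graphH_step (i : nat) (G : plane_graph vertex) : plane_graph vertex :=
  {| vertices := vertices G ++ [:: Vx i.+1; Vy i.+1; Vz i.+1];
     edges := edges G ++ cycle_edges (outer_cycle i);
     inner_faces := inner_faces G ++
       [:: [:: Vx i; Vz i.+1; Vy i; Vz i.-1];
           [:: Vy i; Vx i.+1; Vz i; Vx i.-1];
           [:: Vz i; Vy i.+1; Vx i; Vy i.-1]];
     outer_face := outer_cycle i |}.

(* [graphH_rec n] is H_(n+1). *)
Fixpoint graphH_rec (n : nat) : plane_graph vertex :=
  if n is m.+1 then graphH_step n.+1 (graphH_rec m) else graphH1.

(* Meaningful for [1 <= i]. *)
Definition graphH (i : nat) : plane_graph vertex := graphH_rec i.-1.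

(** * The drawings Gamma_i and Gamma'_i *)

Definition next_vertex (v : vertex) : vertex :=
  match v with Vx j => Vy j.+1 | Vy j => Vz j.+1 | Vz j => Vx j.+1 end.

(* t_j, l_j, r_j for [1 <= j]. *)
Definition t_ (j : nat) : vertex := iter j.-1 next_vertex (Vx 1).
Definition l_ (j : nat) : vertex := iter j.-1 next_vertex (Vz 1).
Definition r_ (j : nat) : vertex := iter j.-1 next_vertex (Vy 1).

Definition level (v : vertex) : nat :=
  match v with Vx j | Vy j | Vz j => j end.

(* The positions of the vertices in Gamma_i do not depend on [i]. The last case
   is that of [v = r_ j], see [Gamma_l], [Gamma_t] and [Gamma_r] below. *)
Definition Gamma (R : realType) (v : vertex) : R * R :=
  let j := level v in
  if v == Vx 0 then (0, 0)
  else if v == t_ j then (0, j%:R)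
  else if v == l_ j then (- j%:R, - j%:R)
  else (j%:R, - j%:R).

Definition displacement (R : realType) (i : nat) (v : vertex) : R * R :=
  if v == r_ i then (1, -1)
  else if (v == r_ i.+1) || (v == l_ i.+1) then (1, 0)
  else if v == t_ i.+1 then (-1, 0)
  else (0, 0).

Definition Gamma' (R : realType) (i : nat) (v : vertex) : R * R :=
  Gamma R v + displacement R i v.

Lemma tlr_step (j : nat) : (0 < j)%N ->
  [/\ t_ j.+1 = next_vertex (t_ j), l_ j.+1 = next_vertex (l_ j)
    & r_ j.+1 = next_vertex (r_ j)].
Proof. by case: j. Qed.

Lemma tlr_level (j : nat) : (0 < j)%N ->
  [/\ level (t_ j) = j, level (l_ j) = j & level (r_ j) = j].
Proof.
have lev v : level (next_vertex v) = (level v).+1 by case: v.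
case: j => // j _; elim: j => [//|j [tj lj rj]].
have [-> -> ->] := tlr_step (ltn0Sn j).
by rewrite !lev tj lj rj.
Qed.

Lemma tlr_perm (j : nat) : (0 < j)%N ->
  perm_eq [:: t_ j; l_ j; r_ j] [:: Vx j; Vy j; Vz j].
Proof.
case: j => // j _; elim: j => [//|j IH].
have [-> -> ->] := tlr_step (ltn0Sn j).
apply: perm_trans (perm_map next_vertex IH) _ => /=.
by rewrite (perm_catC [:: Vy j.+2; Vz j.+2] [:: Vx j.+2]).
Qed.

Lemma tlr_uniq (j : nat) : (0 < j)%N -> uniq [:: t_ j; l_ j; r_ j].
Proof.
by move=> j0; rewrite (perm_uniq (tlr_perm j0)).
Qed.

Lemma Gamma_t (R : realType) (j : nat) : (0 < j)%N ->
  Gamma R (t_ j) = (0, j%:R).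
Proof.
move=> j0; have [tj _ _] := tlr_level j0.
rewrite /Gamma tj eqxx; case: eqP => // tx.
by move: j0; rewrite -tj tx.
Qed.

Lemma Gamma_l (R : realType) (j : nat) : (0 < j)%N ->
  Gamma R (l_ j) = (- j%:R, - j%:R).
Proof.
move=> j0; have [_ lj _] := tlr_level j0.
have := tlr_uniq j0; rewrite /= !inE negb_or => /andP[/andP[tl _] _].
rewrite /Gamma lj eqxx [l_ j == t_ j]eq_sym (negPf tl); case: eqP => // lx.
by move: j0; rewrite -lj lx.
Qed.

Lemma Gamma_r (R : realType) (j : nat) : (0 < j)%N ->
  Gamma R (r_ j) = (j%:R, - j%:R).
Proof.
move=> j0; have [_ _ rj] := tlr_level j0.
have := tlr_uniq j0; rewrite /= !inE negb_or => /andP[/andP[_ tr] /andP[lr _]].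
rewrite /Gamma rj ![r_ j == _]eq_sym (negPf tr) (negPf lr); case: eqP => // rx.
by move: j0; rewrite -rj -rx.
Qed.

(* Main.v *)
Require Import Defs.
From mathcomp Require Import all_boot all_order all_algebra.
From mathcomp Require Import all_classical all_reals all_analysis.
From mathcomp Require Import ring lra zify.

Set Implicit Arguments.
Unset Strict Implicit.
Unset Printing Implicit Defensive.

Import Order.TTheory GRing.Theory Num.Theory.
Import numFieldNormedType.Exports.

Local Open Scope classical_set_scope.
Local Open Scope card_scope.
Local Open Scope ring_scope.

(* The vertices of Gamma'_i other than x_0 lie on three arms leaving x_0: t_k
   upwards, l_k and r_k along the two lower diagonals; only the last vertex of
   an arm turns aside, into the sector that follows its arm counterclockwise.
   In the sector from an arm A to the next arm B, the edges A_(k+1) B_k are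
   nested and cut the sector into the cells A_k A_(k+1) B_k B_(k-1). Affine
   forms vanishing on the arms and on these edges separate edges and cells,
   which gives planarity. The open cells and the complement of the outer
   hexagon are open, connected and disjoint and cover the complement of the
   drawing, so they are its faces.
   For angle-monotonicity, a path through x_0 works for all pairs of vertices
   on different arms except those formed by l_(i+1) and a vertex r_k, 0 < k,
   which are linked by l_(i+1), l_i, ..., l_(k+1), r_k (for k = i + 1, by
   l_(i+1), r_i, r_(i+1)). *)

(** * Regions bounded by convex polygons *)

(** In Gamma_i the outer hexagon is reflex at t_i, l_i and r_i. The displacements cure this:
    traversed counterclockwise, the cross products of the sides meeting at these corners become i -
    1, i - 1 and 0. So the angle at r_i is always flat, and for i = 1 all three are flat and the
    hexagon is a triangle; innermost cells are flat at A_1 as soon as i > 1, x_0, A_1 and A_2 being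
    collinear. Frontiers are then computed from linear forms and one interior point. The exceptional
    pairs for angle-monotonicity come from the displacement of l_(i+1): the last edge of the left
    arm has slope 3 pi / 2 outwards, while the edge from r_1 to x_0 has slope 3 pi / 4, so no wedge
    of angle pi / 2 holds both. The grid has 2 i + 3 columns and rows because abscissas range from
    -i to i + 2 and ordinates from -i - 1 to i + 1. *)

Lemma components_of_partition (T : topologicalType) (A : set T)
    (UU : set (set T)) :
  (forall U, UU U -> [/\ open U, connected U & U !=set0]) ->
  (forall U V, UU U -> UU V -> U `&` V !=set0 -> U = V) ->
  A = \bigcup_(U in UU) U ->
  forall F, (exists2 p, A p & F = connected_component A p) <-> UU F.
Proof.
move=> okU disj AE.
have comp U p : UU U -> U p -> connected_component A p = U.
  move=> UUU Up; have [oU cU _] := okU U UUU.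
  have subUA : U `<=` A by move=> x Ux; rewrite AE; exists U.
  set C := connected_component A p.
  have UC : U `<=` C by apply: connected_component_max.
  have CA : C `<=` A by exact: connected_component_sub.
  have Cc : connected C by exact: component_connected.
  pose W := \bigcup_(V in [set V | UU V /\ V <> U]) V.
  have oW : open W by apply: bigcup_open => V [/okU[]].
  (* Inside the component [C], the piece [U] is open, and also closed because its complement there
     is covered by the open union [W] of the other pieces; connectedness of [C] then forces
     [C = U]. *)
  have CU : C `&` U = C `&` ~` W.
    apply/seteqP; split=> x [Cx].
      move=> Ux; split=> // -[V [UV VU] Vx]; apply: VU.
      by apply: disj => //; exists x.
    move=> nW; split=> //.
    have := CA _ Cx; rewrite AE => -[V UV Vx].
    have [<-//|nVU] := pselect (V = U).
    by case: nW; exists V.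
  have CUU : C `&` U = U by apply: setIidr.
  rewrite -CUU; apply/esym/Cc.
  - by rewrite CUU; exists p.
  - by exists U.
  - by exists (~` W) => //; exact: open_closedC.
move=> F; split=> [[p Ap ->]|UF].
  have := Ap; rewrite AE => -[U UU_U Up].
  by rewrite -AE (comp U).
have [_ _ [p Fp]] := okU F UF.
exists p; first by rewrite AE; exists F.
by rewrite (comp F).
Qed.

Section PlaneGeometry.
Context {R : realType}.
Implicit Types (p q r a c : R * R) (P : seq (R * R)).

Lemma segmentP p q a : segment p q a <->
  exists t, [/\ 0 <= t, t <= 1 & a = (p.1 + t * (q.1 - p.1), p.2 + t * (q.2 - p.2))].
Proof.
split=> [[t /=]|[t [t0 t1 ->]]].
  by rewrite in_itv/= => /andP[t0 t1] <-; exists t.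
by exists t => //=; rewrite in_itv/= t0.
Qed.

Lemma segment_sym p q : segment p q = segment q p.
Proof.
suff sub (u v : R * R) : segment u v `<=` segment v u by apply/seteqP; split; exact: sub.
move=> a /segmentP[t [t0 t1 ->]]; apply/segmentP; exists (1 - t).
by split; [lra|lra|congr (_, _); ring].
Qed.

Lemma segment_l p q : segment p q p.
Proof.
by apply/segmentP; exists 0; split; rewrite ?mul0r ?addr0 //; case: p.
Qed.

Lemma segment_r p q : segment p q q.
Proof. by rewrite segment_sym; exact: segment_l. Qed.

(** Twice the signed area of the triangle [p], [q], [a]: positive when [a] lies to the left of the
    line from [p] to [q]. *)
Definition orient p q a : R :=
  (q.1 - p.1) * (a.2 - p.2) - (q.2 - p.2) * (a.1 - p.1).

Definition affine (f : R * R -> R) : Prop :=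
  exists x y z : R, forall p, f p = x * p.1 + y * p.2 + z.

Lemma affine_orient p q : affine (orient p q).
Proof.
exists (- (q.2 - p.2)), (q.1 - p.1), ((q.2 - p.2) * p.1 - (q.1 - p.1) * p.2).
by move=> a; rewrite /orient; ring.
Qed.

Lemma affine_opp f : affine f -> affine (fun p => - f p).
Proof.
by move=> [x [y [z fE]]]; exists (- x), (- y), (- z) => p; rewrite fE; ring.
Qed.

Lemma affine_segment f p q t : affine f ->
  f (p.1 + t * (q.1 - p.1), p.2 + t * (q.2 - p.2)) = (1 - t) * f p + t * f q.
Proof. by move=> [x [y [z fE]]]; rewrite !fE /=; ring. Qed.

Lemma affine_continuous f : affine f -> continuous f.
Proof.
move=> [x [y [z fE]]] p; rewrite (_ : f = fun p => x * p.1 + y * p.2 + z); last first.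
  exact/funext.
apply: cvgD; last exact: cvg_cst.
by apply: cvgD; apply: cvgMr; [exact: cvg_fst|exact: cvg_snd].
Qed.

(* Barycentric coordinates: the orientations of [a] with the three sides are
   proportional to its weights on the three opposite corners. *)
Lemma affine_triangle f p q r a : affine f ->
  f a * orient p q r =
  f p * orient q r a + f q * orient r p a + f r * orient p q a.
Proof. by move=> [x [y [z fE]]]; rewrite !fE /orient; ring. Qed.

(** A star-shaped set is a union of segments, each connected as an image of [0, 1], that share the
    centre. *)
Lemma connected_star (A : set (R * R)) c :
  A c -> (forall a, A a -> segment c a `<=` A) -> connected A.
Proof.
move=> Ac cA.
have -> : A = \bigcup_(a in A) segment c a.
  apply/seteqP; split=> [a Aa|a [b Ab]]; last exact: cA.
  by exists a => //; exact: segment_r.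
apply: bigcup_connected.
  by exists c => a _; exact: segment_l.
move=> a _; apply: connected_continuous_connected.
  by apply/connected_intervalP; exact: interval_is_interval.
apply: continuous_subspaceT => t.
apply: cvgD; first exact: cvg_cst.
by apply: cvgZr_tmp; exact: cvg_id.
Qed.

Lemma nbhs_segment (U : set (R * R)) a c : nbhs a U ->
  exists t, [/\ 0 < t, t < 1 & U (a.1 + t * (c.1 - a.1), a.2 + t * (c.2 - a.2))].
Proof.
move=> Ua.
pose g (t : R) := a + t *: (c - a).
have g0 : g 0 = a by rewrite /g scale0r addr0.
have gc : {for 0, continuous g}.
  by apply: cvgD; [exact: cvg_cst|apply: cvgZr_tmp; exact: cvg_id].
have /gc : nbhs (g 0) U by rewrite g0.
rewrite /= => /nbhs_ballP[e /= e0 eU].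
exists (Num.min (e / 2) (1 / 2)); split.
- by rewrite lt_min; apply/andP; split; lra.
- by rewrite gt_min; apply/orP; right; lra.
apply: (eU (Num.min (e / 2) (1 / 2))).
rewrite /ball /= sub0r normrN ger0_norm.
  by rewrite gt_min; apply/orP; left; lra.
by rewrite le_min; apply/andP; split; lra.
Qed.

Definition sides P := zip P (rot 1 P).

(** The intersection of the half-planes to the left of the sides; this is the closed convex set
    delimited by [P] when [P] is convex and runs counterclockwise. *)
Definition region P : set (R * R) :=
  [set a | forall s, s \in sides P -> 0 <= orient s.1 s.2 a].

Definition open_region P : set (R * R) :=
  [set a | forall s, s \in sides P -> 0 < orient s.1 s.2 a].

(** The last clause is a genuine condition on [P]: a point of the region on the line of a side must
    lie on some side, possibly another one, which tolerates consecutive collinear sides. *)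
Definition bounds_region P : Prop :=
  [/\ open_region P !=set0,
      exists M, forall a, region P a -> `|a.1| <= M /\ `|a.2| <= M &
      polygon P =
        [set a | region P a /\ exists2 s, s \in sides P & orient s.1 s.2 a = 0]].

Lemma open_region_sub P : open_region P `<=` region P.
Proof. by move=> a Pa s sP; apply/ltW/Pa. Qed.

Lemma closed_region P : closed (region P).
Proof.
have -> : region P = \bigcap_(s in [set` sides P])
    (orient s.1 s.2 @^-1` [set x : R | 0 <= x]).
  by apply/seteqP; split=> a Pa s; exact: Pa.
apply: closed_bigI => s _; apply: closed_comp; last exact: closed_ge.
by move=> x _; exact/affine_continuous/affine_orient.
Qed.

Lemma open_open_region P : open (open_region P).
Proof.
rewrite /open_region; elim: (sides P) => [|s S IH].
  by rewrite (_ : mkset _ = setT); [exact: openT|apply/seteqP; split].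
rewrite (_ : mkset _ = (orient s.1 s.2 @^-1` [set x : R | 0 < x]) `&`
    [set a | forall s, s \in S -> 0 < orient s.1 s.2 a]); last first.
  apply/seteqP; split=> a.
    move=> Pa; split=> [|u uS]; first by apply: Pa; rewrite inE eqxx.
    by apply: Pa; rewrite inE uS orbT.
  by move=> [as_ aS] u; rewrite inE => /predU1P[->|/aS].
apply: openI => //; apply: open_comp; last exact: open_gt.
by move=> x _; exact/affine_continuous/affine_orient.
Qed.

Lemma region_segment P a c t : region P a -> region P c -> 0 <= t -> t <= 1 ->
  region P (a.1 + t * (c.1 - a.1), a.2 + t * (c.2 - a.2)).
Proof.
move=> Pa Pc t0 t1 s sP; rewrite (affine_segment _ _ _ (affine_orient _ _)).
by apply: addr_ge0; apply: mulr_ge0; rewrite ?(Pa s) ?(Pc s) ?subr_ge0.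
Qed.

Lemma open_region_segment P a c t : region P a -> open_region P c ->
  0 < t -> t <= 1 ->
  open_region P (a.1 + t * (c.1 - a.1), a.2 + t * (c.2 - a.2)).
Proof.
move=> Pa Pc t0 t1 s sP; rewrite (affine_segment _ _ _ (affine_orient _ _)).
by apply: ltr_wpDl; [apply: mulr_ge0|apply: mulr_gt0];
  rewrite ?(Pa s) ?(Pc s) ?subr_ge0.
Qed.

Lemma connected_open_region P : open_region P !=set0 -> connected (open_region P).
Proof.
move=> [c Pc]; apply: (@connected_star _ c) => // a Pa b /segmentP[t [t0 t1 ->]].
have [->|tn0] := eqVneq t 0; first by rewrite !mul0r !addr0 -surjective_pairing.
apply: open_region_segment => //; first exact: open_region_sub.
by rewrite lt_neqAle eq_sym tn0.
Qed.

Lemma interior_region P : open_region P !=set0 -> (region P)° = open_region P.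
Proof.
move=> [c Pc]; apply/seteqP; split=> [a Pa s sP|]; last first.
  rewrite -open_subsetE; [exact: open_region_sub|exact: open_open_region].
have := interior_subset Pa s sP; rewrite le_eqVlt => /predU1P[/esym as0|//].
(* The target is the reflection of the interior point [c] in [a]. A form that vanishes at [a] and is
   positive at [c] is negative there, so a small move towards it would leave the region. *)
have [t [t0 _]] := nbhs_segment (2 * a.1 - c.1, 2 * a.2 - c.2) Pa.
move=> /(_ s sP); rewrite (affine_segment _ _ _ (affine_orient _ _)) as0.
have -> : orient s.1 s.2 (2 * a.1 - c.1, 2 * a.2 - c.2) =
    2 * orient s.1 s.2 a - orient s.1 s.2 c by rewrite /orient /=; ring.
by rewrite as0 !mulr0 add0r sub0r mulrN oppr_ge0 leNgt mulr_gt0 ?(Pc s).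
Qed.

Lemma closure_open_region P : open_region P !=set0 ->
  closure (open_region P) = region P.
Proof.
move=> [c Pc]; apply/seteqP; split=> [a|a Pa U Ua].
  rewrite [X in _ -> X a](closure_id _).1; last exact: closed_region.
  by apply: closureS; exact: open_region_sub.
have [t [t0 t1 Ut]] := nbhs_segment c Ua.
exists (a.1 + t * (c.1 - a.1), a.2 + t * (c.2 - a.2)); split => //.
by apply: open_region_segment => //; exact: ltW.
Qed.

Lemma regionD P :
  region P `\` open_region P =
  [set a | region P a /\ exists2 s, s \in sides P & orient s.1 s.2 a = 0].
Proof.
apply/seteqP; split=> a [Pa].
  move=> /existsNP[s /not_implyP[sP /negP]]; rewrite -leNgt => s0.
  by split=> //; exists s => //; apply/le_anti; rewrite s0 (Pa s).
by move=> [s sP s0]; split=> // /(_ s sP); rewrite s0 ltxx.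
Qed.

Lemma frontier_region P : bounds_region P -> frontier (region P) = polygon P.
Proof.
move=> [ne _ ->]; rewrite -regionD /frontier interior_region//.
by rewrite -(closure_id (region P)).1//; exact: closed_region.
Qed.

Lemma frontier_open_region P : bounds_region P ->
  frontier (open_region P) = polygon P.
Proof.
move=> [ne _ ->]; rewrite -regionD /frontier closure_open_region//.
by rewrite (interior_id (open_region P)).1//; exact: open_open_region.
Qed.

Lemma frontier_regionC P : bounds_region P ->
  frontier (~` region P) = polygon P.
Proof.
move=> [ne _ ->]; rewrite -regionD /frontier closure_setC interior_region//.
rewrite (interior_id (~` region P)).1; last exact/closed_openC/closed_region.
by rewrite setDE setCK setIC setDE.
Qed.

Lemma polygon_sub_region P : bounds_region P -> polygon P `<=` region P.
Proof. by move=> [_ _ ->] a []. Qed.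

Lemma bounded_region P : bounds_region P -> bounded_set (region P).
Proof.
move=> [_ [M PM] _]; exists M; split; first exact: num_real.
move=> x Mx a Pa /=; have [a1 a2] := PM a Pa.
apply: le_trans (ltW Mx).
by rewrite /Num.norm /= ge_max a1.
Qed.

Lemma convex_polygon_bounds P : bounds_region P -> convex_polygon P.
Proof.
move=> bP; have [ne [M PM] _] := bP; exists (region P); split.
- move=> x y l; rewrite !inE => Px Py.
  (* [conv l x y] gives the weight [l] to [x], so the segment is run from [y] to [x]. *)
  have := @region_segment P y x l%:num Py Px.
  have -> : conv l x y = (y.1 + l%:num * (x.1 - y.1), y.2 + l%:num * (x.2 - y.2)) :> R * R.
    transitivity (l%:num * x.1 + (1 - l%:num) * y.1,
                  l%:num * x.2 + (1 - l%:num) * y.2) => //.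
    by congr (_, _); ring.
  by apply; [exact: ge0|exact: le1].
- apply: (@subclosed_compact _ _ (`[-M, M] `*` `[-M, M])).
  + exact: closed_region.
  + by apply: compact_setX; exact: segment_compact.
  + by move=> a /PM[a1 a2]; split; rewrite /= in_itv/= -ler_norml.
- by rewrite interior_region.
- by rewrite frontier_region.
Qed.

End PlaneGeometry.


(** * Separation of segments, convex quadrilaterals, and wedges as cones *)

Section Polygons.
Context {R : realType}.
Implicit Types (p q r s a c o : R * R) (P : seq (R * R)).

(* The separation argument behind planarity. *)
Lemma separated_segments (f : R * R -> R) p q r s a : affine f ->
  0 <= f p -> 0 <= f q -> 0 < f p + f q -> f r <= 0 -> f s <= 0 ->
  segment p q a -> segment r s a -> a = p \/ a = q.
Proof.
move=> af p0 q0 pq r0 s0 /segmentP[t [t0 t1 aE]] /segmentP[u [u0 u1 aE']].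
have fa : f a = (1 - t) * f p + t * f q by rewrite aE affine_segment.
have fa' : f a = (1 - u) * f r + u * f s by rewrite aE' affine_segment.
have fa_le0 : f a <= 0 by rewrite fa'; nra.
have tp : 0 <= (1 - t) * f p by apply: mulr_ge0; lra.
have tq : 0 <= t * f q by exact: mulr_ge0.
have tp0 : (1 - t) * f p = 0 by lra.
have tq0 : t * f q = 0 by lra.
move/eqP: tp0; rewrite mulf_eq0 => /orP[/eqP tE|/eqP fp0].
  right; rewrite aE (_ : t = 1); last lra.
  by rewrite !mul1r !subrKC -surjective_pairing.
move/eqP: tq0; rewrite mulf_eq0 => /orP[/eqP tE|/eqP fq0]; last by exfalso; lra.
by left; rewrite aE tE !mul0r !addr0 -surjective_pairing.
Qed.

Lemma segment_affine_ge0 (f : R * R -> R) p q a : affine f ->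
  0 <= f p -> 0 <= f q -> segment p q a -> 0 <= f a.
Proof.
move=> af p0 q0 /segmentP[t [t0 t1 ->]]; rewrite affine_segment//.
by apply: addr_ge0; apply: mulr_ge0 => //; lra.
Qed.

Lemma segment_affine_gt0 (f : R * R -> R) p q a : affine f ->
  0 < f p -> 0 < f q -> segment p q a -> 0 < f a.
Proof.
move=> af p0 q0 /segmentP[t [t0 t1 ->]]; rewrite affine_segment//.
nra.
Qed.

Lemma segment_affine_eq0 (f : R * R -> R) p q a : affine f ->
  f p = 0 -> f q = 0 -> segment p q a -> f a = 0.
Proof.
move=> af p0 q0 /segmentP[t [t0 t1 ->]]; rewrite affine_segment//.
by rewrite p0 q0 !mulr0 addr0.
Qed.

(** On the line of the side [p q], the parameter of [a] is [orient o p a / orient o p q],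
    nonnegative by the side before. By [one_t], one minus this parameter is
    [orient q r a / orient p q r], nonnegative by the side after. *)
Lemma segment_side o p q r a :
  0 < orient o p q -> 0 < orient p q r -> orient p q a = 0 ->
  0 <= orient o p a -> 0 <= orient q r a -> segment p q a.
Proof.
move=> opq pqr pqa opa qra; apply/segmentP.
have ae1 : orient o p q * (a.1 - p.1) = orient o p a * (q.1 - p.1) +
   orient p q a * (o.1 - p.1) by rewrite /orient; ring.
have ae2 : orient o p q * (a.2 - p.2) = orient o p a * (q.2 - p.2) +
   orient p q a * (o.2 - p.2) by rewrite /orient; ring.
have one_t : orient o p q * orient q r a + orient p q r * orient o p a =
    orient o p q * orient p q r
  - orient p q a * (orient o p q + (o.1 - p.1) * (r.2 - p.2)
                    - (o.2 - p.2) * (r.1 - p.1))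
  by rewrite /orient; ring.
rewrite pqa !mul0r !addr0 ?subr0 in ae1 ae2 one_t.
have n0 : orient o p q != 0 by rewrite gt_eqF.
exists (orient o p a / orient o p q); split.
- by rewrite divr_ge0// ltW.
- rewrite ler_pdivrMr// mul1r -(ler_pM2l pqr) mulrC.
  nra.
- rewrite [LHS]surjective_pairing; congr (_, _).
    by rewrite mulrAC -ae1; field.
  by rewrite mulrAC -ae2; field.
Qed.

Lemma mem_sides P u : u \in sides P -> u.1 \in P /\ u.2 \in P.
Proof.
move=> uP; split.
  rewrite -[P](@unzip1_zip _ _ P (rot 1 P)) ?size_rot//.
  by apply/mapP; exists u.
rewrite -(mem_rot 1) -[rot 1 P](@unzip2_zip _ _ P (rot 1 P)) ?size_rot//.
by apply/mapP; exists u.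
Qed.

(** Side forms are affine, so their signs on the polygon are decided at the corners. The converse
    inclusion is the geometric content, left as the last hypothesis. *)
Lemma bounds_regionI P :
  open_region P !=set0 ->
  (exists M, forall a, region P a -> `|a.1| <= M /\ `|a.2| <= M) ->
  (forall u, u \in sides P -> forall p, p \in P -> 0 <= orient u.1 u.2 p) ->
  (forall a u, region P a -> u \in sides P -> orient u.1 u.2 a = 0 ->
     polygon P a) ->
  bounds_region P.
Proof.
move=> ne bd corner side; split => //; apply/seteqP; split=> [a|a [Pa [s sP s0]]].
  move=> [s sP sa]; split.
    move=> u uP; have [s1 s2] := mem_sides sP.
    by apply: segment_affine_ge0 sa;
      [exact: affine_orient|exact: corner|exact: corner].
  exists s => //; apply: segment_affine_eq0 sa; first exact: affine_orient.
    by rewrite /orient; ring.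
  by rewrite /orient; ring.
exact: side Pa sP s0.
Qed.

Lemma orient_rot p q r : orient q r p = orient p q r.
Proof. by rewrite /orient; ring. Qed.

Lemma orient_swap p q r : orient q p r = - orient p q r.
Proof. by rewrite /orient; ring. Qed.

Lemma triangle_affine_ge0 (f : R * R -> R) p q r a : affine f ->
  0 < orient p q r -> 0 <= f p -> 0 <= f q -> 0 <= f r ->
  0 <= orient p q a -> 0 <= orient q r a -> 0 <= orient r p a -> 0 <= f a.
Proof.
move=> af pqr p0 q0 r0 pq qr rp.
rewrite -(pmulr_lge0 _ pqr) (affine_triangle _ _ _ _ af).
by do 2?apply: addr_ge0; apply: mulr_ge0.
Qed.

(* Either a strictly convex quadrilateral or a triangle [s q r] with an extra
   vertex [p] in its side [s q]. *)
Definition convex_quad p q r s : Prop :=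
  [/\ 0 < orient p q r, 0 < orient q r s, 0 < orient r s p &
      0 < orient s p q \/
      exists t, [/\ 0 < t, t < 1 &
        p = (s.1 + t * (q.1 - s.1), s.2 + t * (q.2 - s.2))]].

Lemma sides4 p q r s : sides [:: p; q; r; s] =
  [:: (p, q); (q, r); (r, s); (s, p)].
Proof. by []. Qed.

Lemma region4 p q r s a : region [:: p; q; r; s] a <->
  [/\ 0 <= orient p q a, 0 <= orient q r a, 0 <= orient r s a & 0 <= orient s p a].
Proof.
rewrite /region /= sides4; split=> [H|[pq qr rs sp] u].
  by split; [apply: (H (p, q))|apply: (H (q, r))|apply: (H (r, s))|apply: (H (s, p))];
    rewrite !inE eqxx ?orbT.
by rewrite !inE => /or4P[] /eqP->.
Qed.

Lemma open_region4 p q r s a : open_region [:: p; q; r; s] a <->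
  [/\ 0 < orient p q a, 0 < orient q r a, 0 < orient r s a & 0 < orient s p a].
Proof.
rewrite /open_region /= sides4; split=> [H|[pq qr rs sp] u].
  by split; [apply: (H (p, q))|apply: (H (q, r))|apply: (H (r, s))|apply: (H (s, p))];
    rewrite !inE eqxx ?orbT.
by rewrite !inE => /or4P[] /eqP->.
Qed.

Lemma polygon4 p q r s a : polygon [:: p; q; r; s] a <->
  [\/ segment p q a, segment q r a, segment r s a | segment s p a].
Proof.
rewrite /polygon -/(sides _) sides4; split=> [[u]|].
  rewrite !inE => /or4P[] /eqP-> H; [apply: Or41|apply: Or42|apply: Or43|apply: Or44] => //.
by case=> H; [exists (p, q)|exists (q, r)|exists (r, s)|exists (s, p)];
  rewrite // !inE eqxx ?orbT.
Qed.

(** The diagonal [p r] cuts the quadrilateral into the triangles [p q r] and [r s p], nondegenerate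
    even when [p] lies on the segment [s q]; in the one containing [a], the value [f a] is a
    barycentric combination of corner values. *)
Lemma quad_affine_ge0 (f : R * R -> R) p q r s a : affine f ->
  convex_quad p q r s -> region [:: p; q; r; s] a ->
  0 <= f p -> 0 <= f q -> 0 <= f r -> 0 <= f s -> 0 <= f a.
Proof.
move=> af [pqr qrs rsp _] /region4[pq qr rs sp] p0 q0 r0 s0.
have [pr|/ltW rp] := leP 0 (orient p r a).
  by apply: (@triangle_affine_ge0 f r s p).
by apply: (@triangle_affine_ge0 f p q r) => //; rewrite orient_swap oppr_ge0.
Qed.

Lemma quad_bounds_region p q r s : convex_quad p q r s ->
  bounds_region [:: p; q; r; s].
Proof.
move=> quad; have [pqr qrs rsp pspq] := quad.
have spq : 0 <= orient s p q.
  case: pspq => [/ltW//|[t [_ _ ->]]].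
  by rewrite le_eqVlt; apply/orP; left; apply/eqP; rewrite /orient /=; ring.
have zl u v : orient u v u = 0 :> R by rewrite /orient; ring.
have zr u v : orient u v v = 0 :> R by rewrite /orient; ring.
apply: bounds_regionI.
(* Any mean with positive weights is interior: each side form is nonnegative at all corners and
   positive at one of them. *)
- exists ((p.1 + q.1 + 2 * r.1 + s.1) / 5, (p.2 + q.2 + 2 * r.2 + s.2) / 5).
  have mid u v : orient u v ((p.1 + q.1 + 2 * r.1 + s.1) / 5,
                             (p.2 + q.2 + 2 * r.2 + s.2) / 5) =
    (orient u v p + orient u v q + 2 * orient u v r + orient u v s) / 5.
    by rewrite /orient /=; field.
  have e1 : orient p q s = orient s p q by rewrite /orient; ring.
  have e2 : orient q r p = orient p q r by rewrite /orient; ring.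
  have e3 : orient r s q = orient q r s by rewrite /orient; ring.
  have e4 : orient s p r = orient r s p by rewrite /orient; ring.
  by apply/open_region4; rewrite !mid !zl !zr e1 e2 e3 e4; split; lra.
- pose M := foldr (fun c m => Num.max (Num.max `|c.1| `|c.2|) m) 0 [:: p; q; r; s].
  have cornerM c : c \in [:: p; q; r; s] -> `|c.1| <= M /\ `|c.2| <= M.
    by rewrite !inE => /or4P[] /eqP->; rewrite /M /= !le_max !lexx !orbT.
  exists M.
  move=> a Pa.
  have bd (f : R * R -> R) : affine f ->
    f p <= M -> f q <= M -> f r <= M -> f s <= M -> f a <= M.
    move=> [x [y [z fE]]] p0 q0 r0 s0; rewrite -subr_ge0.
    apply: (quad_affine_ge0 _ quad Pa (f := fun a => M - f a)); rewrite ?subr_ge0//.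
    by exists (- x), (- y), (M - z) => b; rewrite fE; ring.
  have A1 : affine (fun a => a.1 : R) by exists 1, 0, 0 => b; ring.
  have A2 : affine (fun a => a.2 : R) by exists 0, 1, 0 => b; ring.
  have A1' := affine_opp A1; have A2' := affine_opp A2.
  have ler_normN (x : R) : - x <= `|x| by rewrite -normrN ler_norm.
  have cM c : c \in [:: p; q; r; s] -> [/\ c.1 <= M, - c.1 <= M, c.2 <= M & - c.2 <= M].
    by move=> /cornerM[c1 c2]; split;
    [apply: le_trans c1|apply: le_trans c1|apply: le_trans c2|apply: le_trans c2];
    rewrite ?ler_norm ?ler_normN.
  have [] : [/\ p \in [:: p; q; r; s], q \in [:: p; q; r; s],
                r \in [:: p; q; r; s] & s \in [:: p; q; r; s]].
    by split; rewrite !inE eqxx ?orbT.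
  move=> /cM[? ? ? ?] /cM[? ? ? ?] /cM[? ? ? ?] /cM[? ? ? ?].
  by split; rewrite ler_norml lerNl; apply/andP; split;
   [apply: (bd _ A1')|apply: (bd _ A1)|apply: (bd _ A2')|apply: (bd _ A2)].
- move=> u; rewrite sides4 => uS c cP; move: uS cP; rewrite !inE.
  have e1 : orient p q s = orient s p q by rewrite /orient; ring.
  have e2 : orient q r p = orient p q r by rewrite /orient; ring.
  have e3 : orient r s q = orient q r s by rewrite /orient; ring.
  have e4 : orient s p r = orient r s p by rewrite /orient; ring.
  by move=> /or4P[] /eqP-> /or4P[] /eqP->; rewrite /= ?zl ?zr ?e1 ?e2 ?e3 ?e4 // ltW.
move=> a u /region4[pqa qra rsa spa]; rewrite sides4 !inE.
case: pspq => [{}spq|[t [t0 t1 pE]]].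
  move=> /or4P[] /eqP-> /= u0; apply/polygon4.
  - by apply: Or41; apply: (segment_side (o := s) (r := r)).
  - by apply: Or42; apply: (segment_side (o := p) (r := s)).
  - by apply: Or43; apply: (segment_side (o := q) (r := p)).
  - by apply: Or44; apply: (segment_side (o := r) (r := q)).
(* With [p] inside the side [s q] of the triangle [s q r], the forms of [p q] and [s p] are positive
   multiples of that of [s q]. A zero of either one is thus on the segment [s q], and its place
   relative to [p] tells which half contains it. *)
have pq' b : orient p q b = (1 - t) * orient s q b by rewrite pE /orient /=; ring.
have sp' b : orient s p b = t * orient s q b by rewrite pE /orient /=; ring.
have sqr : 0 < orient s q r by move: pqr; rewrite pq' pmulr_rgt0// subr_gt0.
have sqa : 0 <= orient s q a by move: spa; rewrite sp' pmulr_rge0.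
have split_side b : segment s q b -> segment s p b \/ segment p q b.
  move=> /segmentP[w [w0 w1 ->]]; have [wt|/ltW tw] := leP w t.
    left; apply/segmentP; exists (w / t); split.
    - by rewrite divr_ge0// ltW.
    - by rewrite ler_pdivrMr// mul1r.
    - by rewrite pE /=; congr (_, _); field; rewrite gt_eqF.
  right; apply/segmentP; exists ((w - t) / (1 - t)); split.
  - by rewrite divr_ge0// subr_ge0// ltW.
  - by rewrite ler_pdivrMr ?subr_gt0// mul1r lerB.
  - by rewrite pE /=; congr (_, _); field; rewrite subr_eq0 gt_eqF.
have side_sq : orient s q a = 0 -> polygon [:: p; q; r; s] a.
  move=> u0; apply/polygon4.
  have /split_side[H|H] : segment s q a.
    apply: (segment_side (o := r) (r := r)) => //.
    by rewrite -orient_rot.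
  by apply: Or44.
  by apply: Or41.
move=> /or4P[] /eqP-> /= u0.
- apply: side_sq; move/eqP: u0; rewrite pq' mulf_eq0 subr_eq0 => /orP[/eqP t1'|/eqP//].
  by rewrite t1' ltxx in t1.
- apply/polygon4/Or42; apply: (segment_side (o := s) (r := s)) => //.
- apply/polygon4/Or43; apply: (segment_side (o := q) (r := q)) => //.
  by rewrite orient_rot.
- apply: side_sq; move/eqP: u0; rewrite sp' mulf_eq0 => /orP[/eqP t0'|/eqP//].
  by rewrite t0' ltxx in t0.
Qed.

(** [x] and [y] are the coordinates of [q - p] in the frame rotated by [beta]. For [x > 0] the angle
    required by [wedge] is [beta + atan (y / x)], and [atan 1 = pi / 4] turns the aperture into the
    linear condition. *)
Lemma wedge_frame (beta x y : R) p q :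
  x = cos beta * (q.1 - p.1) + sin beta * (q.2 - p.2) ->
  y = cos beta * (q.2 - p.2) - sin beta * (q.1 - p.1) ->
  `|y| <= x -> wedge beta p q.
Proof.
move=> xE yE yx.
have cs := cos2Dsin2 beta; rewrite !expr2 in cs.
have dx : q.1 - p.1 = cos beta * x - sin beta * y.
  rewrite -[LHS]mul1r -cs xE yE; ring.
have dy : q.2 - p.2 = sin beta * x + cos beta * y.
  rewrite -[LHS]mul1r -cs xE yE; ring.
have qE : q = (p.1 + (q.1 - p.1), p.2 + (q.2 - p.2)).
  by rewrite !subrKC -surjective_pairing.
have pi0 := pi_gt0 R.
have [x0|xN0] := eqVneq x 0.
  have y0 : y = 0.
    by apply: normr0_eq0; apply: le_anti; rewrite normr_ge0 andbT (le_trans yx)// x0.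
  exists 0, beta; split=> //.
    by apply/andP; split; lra.
  by rewrite scale0r addr0 qE dx dy x0 y0 !mulr0 subr0 !addr0 -surjective_pairing.
have x0 : 0 < x by rewrite lt_neqAle eq_sym xN0 (le_trans (normr_ge0 y)).
pose phi := atan (y / x).
have cphi : 0 < cos phi by rewrite cos_gt0_pihalf// atan_gtNpi2 atan_ltpi2.
have tphi : sin phi = y / x * cos phi.
  by rewrite -[y / x]atanK -/phi /tan divfK// gt_eqF.
exists (x / cos phi), (beta + phi); split.
- by rewrite divr_ge0// ltW.
- move: yx; rewrite ler_norml => /andP[yx1 yx2].
  have : atan (y / x) <= atan 1 by rewrite le_atan// ler_pdivrMr// mul1r.
  have : atan (- 1) <= atan (y / x) by rewrite le_atan// ler_pdivlMr// mulN1r.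
  by rewrite atanN atan1 -/phi => *; apply/andP; split; lra.
- rewrite cosD sinD tphi [LHS]qE dx dy [RHS]surjective_pairing /=.
  by congr (_, _); rewrite /GRing.scale /=; field; rewrite xN0 gt_eqF.
Qed.

(** [C] is a cone of directions: being stable under scaling by [t >= 0], it passes from the
    end-point [q] to the whole segment. *)
Lemma segment_sub_wedge (beta : R) (C : R -> R -> Prop) :
  (forall t x y, 0 <= t -> C x y -> C (t * x) (t * y)) ->
  (forall p q, C (q.1 - p.1) (q.2 - p.2) -> wedge beta p q) ->
  forall p q, C (q.1 - p.1) (q.2 - p.2) -> segment p q `<=` wedge beta p.
Proof.
move=> Ct Cw p q Cpq a /segmentP[t [t0 _ ->]]; apply: Cw => /=.
by rewrite ![_ + t * _]addrC !addrK; exact: Ct.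
Qed.

(** The angle is chosen before the segment, so that a single [beta] serves all edges of a path. *)
Lemma wedge_down : exists beta : R, forall p q,
  `|q.1 - p.1| <= p.2 - q.2 -> segment p q `<=` wedge beta p.
Proof.
exists (- (pi / 2)) => p q pq.
apply: (segment_sub_wedge (C := fun x y => `|x| <= - y)) => [t x y t0 xy|u v uv|].
- by rewrite normrM ger0_norm// -mulrN ler_wpM2l.
- apply: (wedge_frame _ _ uv); rewrite cosN sinN cos_pihalf sin_pihalf; ring.
- by rewrite opprB.
Qed.

Lemma wedge_left : exists beta : R, forall p q,
  `|q.2 - p.2| <= p.1 - q.1 -> segment p q `<=` wedge beta p.
Proof.
exists pi => p q pq.
apply: (segment_sub_wedge (C := fun x y => `|y| <= - x)) => [t x y t0 xy|u v uv|].
- by rewrite normrM ger0_norm// -mulrN ler_wpM2l.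
- rewrite -normrN in uv.
  by apply: (wedge_frame _ _ uv); rewrite cospi sinpi; ring.
- by rewrite opprB.
Qed.

(** The common value of sine and cosine is a mere positive factor in the rotated coordinates, so it
    need not be computed; the equality comes from [tan (pi / 4) = 1]. *)
Lemma cos_sin_piquarter : sin (pi / 4) = cos (pi / 4) :> R /\ 0 < cos (pi / 4) :> R.
Proof.
have c0 : 0 < cos (pi / 4) :> R.
  by rewrite cos_gt0_pihalf//; have := pi_gt0 R => ?; apply/andP; split; lra.
split=> //; apply: (mulIf (invr_neq0 (lt0r_neq0 c0))).
by rewrite -/(tan _) -atan1 atanK divff// atan1 gt_eqF.
Qed.

Lemma wedge_right_up : exists beta : R, forall p q,
  p.1 <= q.1 -> p.2 <= q.2 -> segment p q `<=` wedge beta p.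
Proof.
have [sc c0] := cos_sin_piquarter.
exists (pi / 4) => p q pq1 pq2.
apply: (segment_sub_wedge (C := fun x y => 0 <= x /\ 0 <= y))
  => [t x y t0 [xy1 xy2]|u v [u1 v1]|].
- by split; apply: mulr_ge0.
- apply: (wedge_frame erefl erefl); rewrite sc.
  by rewrite ler_norml; apply/andP; split; nra.
- by rewrite !subr_ge0.
Qed.

Lemma wedge_right_down : exists beta : R, forall p q,
  p.1 <= q.1 -> q.2 <= p.2 -> segment p q `<=` wedge beta p.
Proof.
have [sc c0] := cos_sin_piquarter.
exists (- (pi / 4)) => p q pq1 pq2.
apply: (segment_sub_wedge (C := fun x y => 0 <= x /\ y <= 0))
  => [t x y t0 [xy1 xy2]|u v [u1 v1]|].
- by split; [apply: mulr_ge0|apply: mulr_ge0_le0].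
- apply: (wedge_frame erefl erefl); rewrite cosN sinN sc.
  by rewrite ler_norml; apply/andP; split; nra.
- by rewrite subr_ge0 subr_le0.
Qed.

End Polygons.


(** * The graphs H_i in terms of their three arms *)

Inductive arm := Top | Left | Right.

(* The next arm counterclockwise. *)
Definition next_arm (A : arm) : arm :=
  match A with Top => Left | Left => Right | Right => Top end.

(* All three arms start at [x_0]. *)
Definition arm_vertex (A : arm) (k : nat) : vertex :=
  if k is 0 then Vx 0
  else match A with Top => t_ k | Left => l_ k | Right => r_ k end.

Arguments arm_vertex : simpl never.

(** The labels rotate with period three in the level and only even permutations occur:
    counterclockwise, the arms always read x, z, y up to rotation. Hence at every level the edges
    across join each arm to the same neighbour. *)
Lemma tlr_cases k : (0 < k)%N ->
  [\/ [/\ t_ k = Vx k, l_ k = Vz k & r_ k = Vy k],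
      [/\ t_ k = Vy k, l_ k = Vx k & r_ k = Vz k] |
      [/\ t_ k = Vz k, l_ k = Vy k & r_ k = Vx k]].
Proof.
case: k => // k _; elim: k => [|k]; first by apply: Or31.
have [-> -> ->] := tlr_step (ltn0Sn k).
case=> -[-> -> ->] /=; [exact: Or32|exact: Or33|exact: Or31].
Qed.

Lemma arm_vertexS A k : (0 < k)%N ->
  arm_vertex A k.+1 = next_vertex (arm_vertex A k).
Proof. by case: k => // k _; case: A. Qed.

Lemma arm_vertex_cases k : (0 < k)%N ->
  [\/ [/\ arm_vertex Top k = Vx k, arm_vertex Left k = Vz k &
          arm_vertex Right k = Vy k],
      [/\ arm_vertex Top k = Vy k, arm_vertex Left k = Vx k &
          arm_vertex Right k = Vz k] |
      [/\ arm_vertex Top k = Vz k, arm_vertex Left k = Vy k &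
          arm_vertex Right k = Vx k]].
Proof. by case: k => // k _; apply: tlr_cases. Qed.

Lemma level_arm_vertex A k : level (arm_vertex A k) = k.
Proof.
by case: k => // k; have [] := tlr_level (ltn0Sn k); case: A.
Qed.

Lemma arm_vertex_inj A B k m : arm_vertex A k = arm_vertex B m ->
  k = m /\ (A = B \/ k = 0%N).
Proof.
move=> E; have km : k = m by rewrite -(level_arm_vertex A k) E level_arm_vertex.
split=> //; move: E; rewrite -km; case: k {km} => [|k]; first by right.
have := tlr_cases (ltn0Sn k).
by case: A; case: B; case=> -[E1 E2 E3]; rewrite /arm_vertex ?E1 ?E2 ?E3 //; left.
Qed.

(** The second alternative is there for [Vy 0] and [Vz 0], which are values of [vertex] but lie on
    no arm. *)
Lemma arm_vertexP v : exists A, v = arm_vertex A (level v) \/ (level v = 0)%N.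
Proof.
case E: (level v) => [|k]; first by exists Top; right.
case: (tlr_cases (ltn0Sn k)) => -[tE lE rE]; case: v E => j /= ->;
  [exists Top|exists Right|exists Left|exists Left|exists Top|exists Right
  |exists Right|exists Left|exists Top];
  by rewrite /= ?tE ?lE ?rE; left.
Qed.

Lemma mem_vertices i v : (0 < i)%N -> v \in vertices (graphH i) <->
  exists A k, (k <= i.+1)%N /\ v = arm_vertex A k.
Proof.
case: i => // i _; rewrite /graphH /=.
have -> : (v \in vertices (graphH_rec i)) =
    (v == Vx 0) || (0 < level v <= i.+2)%N.
  elim: i => [|i IH].
    case: v => j /=; rewrite !inE /=; do ?[case: j => //= j].
  have lt_level (a b : nat) : (0 < a <= b.+1)%N = (0 < a <= b)%N || (a == b.+1).
    by case: a => //= a; rewrite leq_eqVlt orbC.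
  rewrite [vertices _]/= mem_cat IH (lt_level _ i.+2) -orbA; congr (_ || (_ || _)).
  rewrite !inE; case: v {IH} => j; rewrite [level _]/=.
  - exact: orbF.
  - exact: orbF.
  - by [].
split.
  case/predU1P=> [->|/andP[v0 vi]]; first by exists Top, 0%N.
  have [A [vE|v0']] := arm_vertexP v; last by rewrite v0' in v0.
  by exists A, (level v).
move=> [A [[|k] [ki ->]]]; first by rewrite eqxx.
by rewrite level_arm_vertex ki orbT.
Qed.

(* Edges in the directions in which [edges (graphH i)] lists them. *)
Inductive arm_edge (i : nat) : vertex * vertex -> Prop :=
| Spoke A : arm_edge i (arm_vertex A 0, arm_vertex A 1)
| Along A k : (0 < k <= i)%N -> arm_edge i (arm_vertex A k.+1, arm_vertex A k)
| Across A k : (0 < k <= i)%N ->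
    arm_edge i (arm_vertex (next_arm A) k, arm_vertex A k.+1).

Lemma mem_outer_cycle_edges k e : (0 < k)%N ->
  e \in cycle_edges (outer_cycle k) <->
  exists A, e = (arm_vertex A k.+1, arm_vertex A k) \/
            e = (arm_vertex (next_arm A) k, arm_vertex A k.+1).
Proof.
move=> k0; rewrite /cycle_edges /= !inE; split.
  case: (arm_vertex_cases k0) => -[tE lE rE];
  do ?[case/orP]; move/eqP->;
  first [by exists Top; rewrite /next_arm arm_vertexS// ?tE ?lE ?rE; first [by left|by right]
        |by exists Left; rewrite /next_arm arm_vertexS// ?tE ?lE ?rE; first [by left|by right]
        |by exists Right; rewrite /next_arm arm_vertexS// ?tE ?lE ?rE; first [by left|by right]].
by case: (arm_vertex_cases k0) => -[tE lE rE] [[] []->];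
  rewrite /next_arm arm_vertexS// ?tE ?lE ?rE eqxx ?orbT.
Qed.

Lemma mem_edges i e : (0 < i)%N -> e \in edges (graphH i) <-> arm_edge i e.
Proof.
case: i => // i _; rewrite /graphH /=.
elim: i e => [|i IH] e.
  rewrite [edges _](_ : _ = [:: (Vx 0, Vx 1); (Vx 0, Vy 1); (Vx 0, Vz 1)] ++
    cycle_edges (outer_cycle 1)) // mem_cat; split.
    case/orP; last first.
      by move/(mem_outer_cycle_edges _ (ltn0Sn 0)) => [A [->|->]];
        [exact: Along|exact: Across].
    by rewrite !inE => /or3P[] /eqP->;
      [exact: (Spoke _ Top)|exact: (Spoke _ Right)|exact: (Spoke _ Left)].
  case=> [A|A [|[|k]] // _|A [|[|k]] // _].
  - by case: A.
  - by apply/orP; right; apply/mem_outer_cycle_edges => //; exists A; left.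
  - by apply/orP; right; apply/mem_outer_cycle_edges => //; exists A; right.
rewrite [edges _](_ : _ = edges (graphH_rec i) ++
  cycle_edges (outer_cycle i.+2)) // mem_cat; split.
  case/orP => [/IH[A|A k /andP[k0 ki]|A k /andP[k0 ki]]|].
  - exact: Spoke.
  - by apply: Along; rewrite k0 leqW.
  - by apply: Across; rewrite k0 leqW.
  - by move/(mem_outer_cycle_edges _ (ltn0Sn i.+1)) => [A [->|->]];
      [apply: Along|apply: Across]; rewrite leqnn.
case=> [A|A k /andP[k0]|A k /andP[k0]].
- by apply/orP; left; apply/IH/Spoke.
- rewrite leq_eqVlt => /predU1P[->|ki]; apply/orP; [right|left].
    by apply/mem_outer_cycle_edges => //; exists A; left.
  by apply/IH/Along; rewrite k0.
- rewrite leq_eqVlt => /predU1P[->|ki]; apply/orP; [right|left].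
    by apply/mem_outer_cycle_edges => //; exists A; right.
  by apply/IH/Across; rewrite k0.
Qed.

(** Listed counterclockwise in the drawing, so that [orient] is nonnegative inside. For [k = 1] the
    last vertex is x_0. *)
Definition cell_cycle (A : arm) (k : nat) : seq vertex :=
  [:: arm_vertex A k; arm_vertex A k.+1;
      arm_vertex (next_arm A) k; arm_vertex (next_arm A) k.-1].

Definition hexagon_cycle (k : nat) : seq vertex :=
  [:: arm_vertex Top k.+1; arm_vertex Left k; arm_vertex Left k.+1;
      arm_vertex Right k; arm_vertex Right k.+1; arm_vertex Top k].

Lemma outer_face_graphH i : (0 < i)%N -> outer_face (graphH i) = outer_cycle i.
Proof. by case: i => // -[|i]. Qed.

(** The offset varies with the level modulo 3 and does not affect the polygon, which is invariant
    under rotation and reversal of its list. *)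
Lemma outer_cycle_rot k : (0 < k)%N ->
  exists n, outer_cycle k = rot n (rev (hexagon_cycle k)).
Proof.
move=> k0; rewrite /hexagon_cycle !arm_vertexS//.
by case: (arm_vertex_cases k0) => -[-> -> ->]; [exists 3%N|exists 1%N|exists 5%N].
Qed.

(** The facial cycles are listed clockwise, hence the reversal. Those of H_1 start at x_0 and the
    later ones at [arm_vertex (next_arm A) k], hence the rotation for [k] other than 1. *)
Lemma mem_inner_faces i c : (0 < i)%N -> c \in inner_faces (graphH i) <->
  exists A k, (0 < k <= i)%N /\
    c = (if k == 1%N then rev (cell_cycle A k) else rot 1 (rev (cell_cycle A k))).
Proof.
case: i => // i _; rewrite /graphH /=.
elim: i => [|i IH].
  split.
    by rewrite !inE => /or3P[] /eqP->; [exists Top, 1%N|exists Right, 1%N|exists Left, 1%N].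
  by move=> [A [[|[|k]] [// _ ->]]]; case: A.
have step : c \in [:: [:: Vx i.+2; Vz i.+3; Vy i.+2; Vz i.+1];
           [:: Vy i.+2; Vx i.+3; Vz i.+2; Vx i.+1];
           [:: Vz i.+2; Vy i.+3; Vx i.+2; Vy i.+1]] <->
    exists A, c = rot 1 (rev (cell_cycle A i.+2)).
  rewrite /cell_cycle /rev /rot [_.-1]/= !inE; split.
    case: (arm_vertex_cases (ltn0Sn i)) => -[tE lE rE]; case/or3P => /eqP->;
    first [by exists Top; rewrite /next_arm !(arm_vertexS _ (ltn0Sn _)) ?tE ?lE ?rE
          |by exists Left; rewrite /next_arm !(arm_vertexS _ (ltn0Sn _)) ?tE ?lE ?rE
          |by exists Right; rewrite /next_arm !(arm_vertexS _ (ltn0Sn _)) ?tE ?lE ?rE].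
  by case: (arm_vertex_cases (ltn0Sn i)) => -[tE lE rE] [[]->];
    rewrite /next_arm !(arm_vertexS _ (ltn0Sn _)) ?tE ?lE ?rE /= eqxx ?orbT.
rewrite [inner_faces _]/= mem_cat; split.
  case/orP => [/IH[A [k [/andP[k0 ki] ->]]]|/step[A ->]].
    by exists A, k; rewrite k0 leqW.
  by exists A, i.+2; rewrite leqnn.
move=> [A [k [/andP[k0]]]]; rewrite leq_eqVlt => /predU1P[->|ki] cE.
  by apply/orP; right; apply/step; exists A.
by apply/orP; left; apply/IH; exists A, k; rewrite k0.
Qed.


(** * Coordinates of the vertices *)

Section Sectors.
Variable R : realType.
Implicit Types (A : arm) (p : R * R).

Definition arm_dir A : R * R :=
  match A with Top => (0, 1) | Left => (-1, -1) | Right => (1, -1) end.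

(* [(sec_a A p, sec_b A p)] are, up to a positive factor, the coordinates of
   [p] in the basis of the directions of [A] and [next_arm A]. *)
Definition sec_a A p : R :=
  p.1 * (arm_dir (next_arm A)).2 - p.2 * (arm_dir (next_arm A)).1.

Definition sec_b A p : R := (arm_dir A).1 * p.2 - (arm_dir A).2 * p.1.

(** The determinant of the directions of [A] and [next_arm A], which is the factor between [sec_a],
    [sec_b] and true coordinates: 2 for [Left], 1 for the others. *)
Definition sec_det A : R := sec_a A (arm_dir A).

Lemma sec_det_gt0 A : 0 < sec_det A.
Proof. by rewrite /sec_det /sec_a; case: A => /=; lra. Qed.

Lemma affine_sec_a A : affine (sec_a A).
Proof.
exists (arm_dir (next_arm A)).2, (- (arm_dir (next_arm A)).1), 0 => p.
by rewrite /sec_a; ring.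
Qed.

Lemma affine_sec_b A : affine (sec_b A).
Proof.
by exists (- (arm_dir A).2), (arm_dir A).1, 0 => p; rewrite /sec_b; ring.
Qed.

Lemma sector_cover p : exists A, 0 <= sec_a A p /\ 0 <= sec_b A p.
Proof.
have [x0|/ltW x0] := leP p.1 0; have [y|/ltW y] := leP p.1 p.2.
- by exists Top; rewrite /sec_a /sec_b /=; split; lra.
- by exists Left; rewrite /sec_a /sec_b /=; split; lra.
- by exists Right; rewrite /sec_a /sec_b /=; split; lra.
- have [z|/ltW z] := leP (p.1 + p.2) 0.
    by exists Left; rewrite /sec_a /sec_b /=; split; lra.
  by exists Right; rewrite /sec_a /sec_b /=; split; lra.
Qed.

End Sectors.

(** * Vertices in sector coordinates, signs of the separating forms, convexity of the cells *)

Section Positions.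
Variables (R : realType) (i : nat).
Hypothesis i_gt0 : (0 < i)%N.
Implicit Types (A : arm) (k m : nat) (p : R * R).

Local Notation arm_dir := (arm_dir R).
Local Notation sec_det := (sec_det R).

(** The vertex r_i moves by (1, -1), along its own arm, so its displacement only adds one to its
    length. *)
Definition arm_len A k : R :=
  match A with Right => k%:R + (k == i)%:R | _ => k%:R end.

(** Level i + 1 leaves the arm and is given by explicit coordinates; larger [k] receive the same
    value by default. *)
Definition arm_pos A k : R * R :=
  if (k <= i)%N then (arm_len A k * (arm_dir A).1, arm_len A k * (arm_dir A).2)
  else match A with
       | Top => (-1, i%:R + 1)
       | Left => (- i%:R, - i%:R - 1)
       | Right => (i%:R + 2, - i%:R - 1)
       end.

Let i1 : 1 <= i%:R :> R. Proof. by rewrite ler1n. Qed.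

Lemma eq_arm_vertex A B k m : (0 < m)%N ->
  (arm_vertex A k == arm_vertex B m) =
  (k == m) && match A, B with
    Top, Top | Left, Left | Right, Right => true | _, _ => false end.
Proof.
move=> m0; apply/eqP/andP => [/arm_vertex_inj[-> [->|m0']]|[/eqP->]].
- by rewrite eqxx; case: B.
- by rewrite m0' in m0.
- by case: A; case: B.
Qed.

Lemma Gamma_arm_vertex A k :
  Gamma R (arm_vertex A k) = (k%:R * (arm_dir A).1, k%:R * (arm_dir A).2).
Proof.
case: k => [|k]; first by rewrite !mul0r /Gamma eqxx.
case: A; rewrite /arm_vertex /= ?mulr0 ?mulr1 ?mulrN1.
- exact: Gamma_t.
- exact: Gamma_l.
- exact: Gamma_r.
Qed.

Let pairD (x y z t : R) : (x, y) + (z, t) = (x + z, y + t) :> R * R.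
Proof. by []. Qed.

Lemma Gamma'_arm_vertex A k : (k <= i.+1)%N ->
  Gamma' R i (arm_vertex A k) = arm_pos A k.
Proof.
move=> ki; rewrite /Gamma' Gamma_arm_vertex /displacement.
have rE : r_ i = arm_vertex Right i by case: (i) i_gt0.
have := eq_arm_vertex A Right k i_gt0; rewrite -rE => ->.
rewrite -[r_ i.+1]/(arm_vertex Right i.+1) -[l_ i.+1]/(arm_vertex Left i.+1).
rewrite -[t_ i.+1]/(arm_vertex Top i.+1) !eq_arm_vertex//.
rewrite /arm_pos; case: ltngtP ki => // [ki|->] _.
  rewrite -ltnS ki; have [kE|kN] := eqVneq k i.
    by rewrite /arm_len kE eqxx; case: A => /=; rewrite pairD; congr (_, _); ring.
  by rewrite /arm_len (negPf kN); case: A => /=; rewrite pairD; congr (_, _); ring.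
rewrite (gtn_eqF (ltnSn i)).
by rewrite ltnn; case: A => /=; rewrite pairD -natr1; congr (_, _); ring.
Qed.

Lemma arm_len0 A : arm_len A 0 = 0.
Proof. by case: A; rewrite /arm_len //= -[0%N]/(0%N) eq_sym gtn_eqF// addr0. Qed.

Lemma arm_pos0 A : arm_pos A 0 = (0, 0).
Proof. by rewrite /arm_pos /= arm_len0 !mul0r. Qed.

Lemma arm_len_lt A k m : (k < m <= i)%N -> arm_len A k < arm_len A m.
Proof.
move=> /andP[km mi]; have kmR : k%:R < m%:R :> R by rewrite ltr_nat.
case: A => //=; rewrite (ltn_eqF (leq_trans km mi)) addr0.
by apply: (lt_le_trans kmR); rewrite lerDl.
Qed.

Lemma arm_len_gt0 A k : (0 < k <= i)%N -> 0 < arm_len A k.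
Proof. by move=> ki; rewrite -(arm_len0 A); exact: arm_len_lt. Qed.

Lemma arm_len_ge0 A k : 0 <= arm_len A k.
Proof. by case: A => /=; rewrite ?addr_ge0. Qed.

Lemma arm_len_le A k : (k <= i)%N -> arm_len A k <= arm_len A i.
Proof.
rewrite leq_eqVlt => /predU1P[->//|ki]; apply/ltW/arm_len_lt.
by rewrite ki leqnn.
Qed.

Lemma arm_posE A k : (k <= i)%N ->
  arm_pos A k = (arm_len A k * (arm_dir A).1, arm_len A k * (arm_dir A).2).
Proof. by rewrite /arm_pos => ->. Qed.

Lemma sec_a_arm A k : (k <= i)%N -> sec_a A (arm_pos A k) = arm_len A k * sec_det A.
Proof. by move=> ki; rewrite arm_posE// /sec_det /sec_a /=; ring. Qed.

Lemma sec_b_arm A k : (k <= i)%N -> sec_b A (arm_pos A k) = 0.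
Proof. by move=> ki; rewrite arm_posE// /sec_b /=; ring. Qed.

Lemma sec_a_next A k : (k <= i)%N -> sec_a A (arm_pos (next_arm A) k) = 0.
Proof. by move=> ki; rewrite arm_posE// /sec_a /=; ring. Qed.

Lemma sec_b_next A k : (k <= i)%N ->
  sec_b A (arm_pos (next_arm A) k) = arm_len (next_arm A) k * sec_det A.
Proof. by move=> ki; rewrite arm_posE// /sec_det /sec_a /sec_b /=; ring. Qed.

Let topE A : arm_pos A i.+1 = match A with
       | Top => (-1, i%:R + 1)
       | Left => (- i%:R, - i%:R - 1)
       | Right => (i%:R + 2, - i%:R - 1)
       end.
Proof. by rewrite /arm_pos ltnn. Qed.

(** Although the last vertex turns aside, its [sec_a] does not fall below that of level i, so the
    edges of lower levels still separate it from x_0. *)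
Lemma sec_a_top A : arm_len A i * sec_det A <= sec_a A (arm_pos A i.+1).
Proof.
by rewrite topE /sec_det /sec_a; case: A => /=; rewrite ?eqxx /=; lra.
Qed.

Lemma sec_b_top A : 0 < sec_b A (arm_pos A i.+1).
Proof. by rewrite topE /sec_b; have := i1; case: A => /=; lra. Qed.

Lemma sec_a_next_top A : sec_a A (arm_pos (next_arm A) i.+1) < 0.
Proof. by rewrite topE /sec_a; have := i1; case: A => /=; lra. Qed.

Lemma sec_b_next_top A : 0 < sec_b A (arm_pos (next_arm A) i.+1).
Proof. by rewrite topE /sec_b; have := i1; case: A => /=; lra. Qed.

Lemma sec_b_prev_top A : sec_b A (arm_pos (next_arm (next_arm A)) i.+1) < 0.
Proof. by rewrite topE /sec_b; have := i1; case: A => /=; lra. Qed.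

(** The directions satisfy 2 Top + Left + Right = 0, so each is a negative combination of the other
    two, and the third arm makes both forms of the sector negative. *)
Lemma sec_a_prev A k : (0 < k <= i)%N ->
  sec_a A (arm_pos (next_arm (next_arm A)) k) < 0.
Proof.
move=> /andP[k0 ki]; rewrite arm_posE// /sec_a.
have : 0 < arm_len (next_arm (next_arm A)) k by rewrite arm_len_gt0// k0.
by move: (arm_len _ k) => l; case: A => /= l0; lra.
Qed.

Lemma sec_b_prev A k : (0 < k <= i)%N ->
  sec_b A (arm_pos (next_arm (next_arm A)) k) < 0.
Proof.
move=> /andP[k0 ki]; rewrite arm_posE// /sec_b.
have : 0 < arm_len (next_arm (next_arm A)) k by rewrite arm_len_gt0// k0.
by move: (arm_len _ k) => l; case: A => /= l0; lra.
Qed.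

(** The intercept form of the line cutting the two arms at lengths [arm_len A k] and
    [arm_len (next_arm A) m]; it is nonnegative at x_0. *)
Lemma orient_across A k m p : (k <= i)%N -> (m <= i)%N ->
  orient (arm_pos A k) (arm_pos (next_arm A) m) p =
  arm_len A k * arm_len (next_arm A) m * sec_det A
  - arm_len (next_arm A) m * sec_a A p - arm_len A k * sec_b A p.
Proof.
by move=> ki mi; rewrite !arm_posE// /orient /sec_det /sec_a /sec_b /=; ring.
Qed.

Lemma orient_along A k m p : (k <= i)%N -> (m <= i)%N ->
  orient (arm_pos A k) (arm_pos A m) p = (arm_len A m - arm_len A k) * sec_b A p.
Proof. by move=> ki mi; rewrite !arm_posE// /orient /sec_b /=; ring. Qed.

Lemma orient_next A k m p : (k <= i)%N -> (m <= i)%N ->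
  orient (arm_pos (next_arm A) k) (arm_pos (next_arm A) m) p =
  (arm_len (next_arm A) k - arm_len (next_arm A) m) * sec_a A p.
Proof. by move=> ki mi; rewrite !arm_posE// /orient /sec_a /=; ring. Qed.

Lemma arm_len_step_gt0 A k : (0 < k <= i)%N -> 0 < arm_len A k - arm_len A k.-1.
Proof.
by case: k => // k /= ki; rewrite subr_gt0 arm_len_lt// ltnSn.
Qed.

(* At level [i] the vertex [arm_pos A i.+1] leaves the arm for the interior of
   the sector; otherwise it is further away on the arm. *)
Lemma sec_arm_succ A k : (0 < k <= i)%N ->
  [/\ arm_len A k * sec_det A <= sec_a A (arm_pos A k.+1),
      0 <= sec_b A (arm_pos A k.+1) &
      if k == i then 0 < sec_b A (arm_pos A k.+1)
      else arm_len A k * sec_det A < sec_a A (arm_pos A k.+1)].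
Proof.
move=> /andP[k0]; rewrite leq_eqVlt => /predU1P[->|ki].
  by rewrite eqxx; split; [exact: sec_a_top|exact/ltW/sec_b_top|exact: sec_b_top].
rewrite ltn_eqF// sec_a_arm// sec_b_arm//.
have lt : arm_len A k * sec_det A < arm_len A k.+1 * sec_det A.
  by rewrite ltr_pM2r ?sec_det_gt0// arm_len_lt// ltnSn.
by split; rewrite // ltW.
Qed.

Lemma sec_a_arm_ge0 A k : (k <= i.+1)%N -> 0 <= sec_a A (arm_pos A k).
Proof.
rewrite leq_eqVlt => /predU1P[->|ki].
  apply: le_trans (sec_a_top A); rewrite mulr_ge0 ?arm_len_ge0//.
  exact/ltW/sec_det_gt0.
by rewrite sec_a_arm// mulr_ge0 ?arm_len_ge0//; exact/ltW/sec_det_gt0.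
Qed.

Lemma sec_a_arm_gt0 A k : (0 < k <= i.+1)%N -> 0 < sec_a A (arm_pos A k).
Proof.
move=> /andP[k0]; rewrite leq_eqVlt => /predU1P[->|ki].
  apply: lt_le_trans (sec_a_top A); rewrite mulr_gt0 ?arm_len_gt0 ?leqnn ?i_gt0//.
  exact: sec_det_gt0.
by rewrite sec_a_arm// mulr_gt0 ?arm_len_gt0 ?k0//; exact: sec_det_gt0.
Qed.

Lemma sec_b_arm_ge0 A k : (k <= i.+1)%N -> 0 <= sec_b A (arm_pos A k).
Proof.
rewrite leq_eqVlt => /predU1P[->|ki]; first exact/ltW/sec_b_top.
by rewrite sec_b_arm.
Qed.

Lemma sec_b_next_ge0 A k : (k <= i)%N -> 0 <= sec_b A (arm_pos (next_arm A) k).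
Proof.
move=> ki; rewrite sec_b_next// mulr_ge0 ?arm_len_ge0//.
exact/ltW/sec_det_gt0.
Qed.

Lemma sec_b_next_gt0 A k : (0 < k <= i)%N -> 0 < sec_b A (arm_pos (next_arm A) k).
Proof.
move=> /andP[k0 ki]; rewrite sec_b_next// mulr_gt0 ?arm_len_gt0 ?k0//.
exact: sec_det_gt0.
Qed.

(* Level lines: the points of levels above [k] lie beyond the line through
   [arm_pos A k.+1] and [arm_pos (next_arm A) k]. *)
Lemma orient_across_arm_le0 A k m : (k < i)%N -> (k < m <= i.+1)%N ->
  orient (arm_pos A k.+1) (arm_pos (next_arm A) k) (arm_pos A m) <= 0.
Proof.
move=> ki /andP[km mi]; rewrite orient_across//; last exact: ltnW.
rewrite subr_le0.
apply: le_trans (_ : 0 <= _); last first.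
  by rewrite mulr_ge0 ?arm_len_ge0 ?sec_b_arm_ge0.
suff lea : arm_len A k.+1 * sec_det A <= sec_a A (arm_pos A m).
  rewrite subr_le0 mulrAC mulrC ler_wpM2l ?arm_len_ge0//.
have kS : arm_len A k.+1 * sec_det A = sec_a A (arm_pos A k.+1) by rewrite sec_a_arm.
move: mi km; rewrite leq_eqVlt => /predU1P[-> _|mi km].
  apply: le_trans (sec_a_top A); rewrite ler_wpM2r ?arm_len_le//.
  exact/ltW/sec_det_gt0.
rewrite sec_a_arm// ler_wpM2r//; first exact/ltW/sec_det_gt0.
move: km; rewrite leq_eqVlt => /predU1P[->//|km].
by apply/ltW/arm_len_lt; rewrite km.
Qed.

(** Strictness requires [0 < k]: for [k = 0] the line is the arm [A] itself and contains its
    vertices up to level i. *)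
Lemma orient_across_arm_lt0 A k m : (0 < k < i)%N -> (k.+1 < m <= i.+1)%N ->
  orient (arm_pos A k.+1) (arm_pos (next_arm A) k) (arm_pos A m) < 0.
Proof.
move=> /andP[k0 ki] /andP[km]; rewrite orient_across//; last exact: ltnW.
have d0 := sec_det_gt0 R A.
have l0 : 0 < arm_len (next_arm A) k by rewrite arm_len_gt0// k0 ltnW.
have l1 : 0 < arm_len A k.+1 by rewrite arm_len_gt0.
rewrite leq_eqVlt => /predU1P[->|mi].
  have := sec_a_top A; have := sec_b_top A; have := arm_len_le A ki => ? ? ?.
  have : arm_len A k.+1 * sec_det A <= sec_a A (arm_pos A i.+1) by nra.
  move=> ?; nra.
have : arm_len A k.+1 < arm_len A m by rewrite arm_len_lt// km.
rewrite sec_a_arm// sec_b_arm// mulr0 subr0 => ?.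
have : 0 < arm_len (next_arm A) k * sec_det A * (arm_len A m - arm_len A k.+1).
  by apply: mulr_gt0; [exact: mulr_gt0|rewrite subr_gt0].
by move=> ?; lra.
Qed.

Lemma orient_across_next_le0 A k m : (k < i)%N -> (k <= m <= i)%N ->
  orient (arm_pos A k.+1) (arm_pos (next_arm A) k) (arm_pos (next_arm A) m) <= 0.
Proof.
move=> ki /andP[km mi]; rewrite orient_across//; last exact: ltnW.
rewrite sec_a_next// sec_b_next// mulr0 subr0 -mulrA -mulrBr -mulrBl.
have d0 := sec_det_gt0 R A; have l0 := arm_len_ge0 A k.+1.
rewrite mulr_ge0_le0// mulr_le0_ge0 ?(ltW d0)// subr_le0.
move: km; rewrite leq_eqVlt => /predU1P[->//|km].
by apply/ltW/arm_len_lt; rewrite km.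
Qed.

Lemma orient_across_next_lt0 A k m : (k < m <= i)%N ->
  orient (arm_pos A k.+1) (arm_pos (next_arm A) k) (arm_pos (next_arm A) m) < 0.
Proof.
move=> kmi; have /andP[km mi] := kmi; have ki := leq_trans km mi.
rewrite orient_across//; last exact: ltnW.
rewrite sec_a_next// sec_b_next// mulr0 subr0 -mulrA -mulrBr -mulrBl.
have d0 := sec_det_gt0 R A; have l0 : 0 < arm_len A k.+1 by rewrite arm_len_gt0.
by rewrite pmulr_rlt0// pmulr_llt0// subr_lt0 arm_len_lt.
Qed.

(** Three turns are strict at all levels. The one at A_k is strict for [k = i] because A_(i+1) turns
    aside, and for [1 < k < i] because B_(k-1) is not x_0, with [B = next_arm A]; for [k = 1 < i]
    the points x_0, A_1, A_2 are collinear, which is the flat case of [convex_quad]. *)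
Lemma cell_convex A k : (0 < k <= i)%N ->
  convex_quad (arm_pos A k) (arm_pos A k.+1)
              (arm_pos (next_arm A) k) (arm_pos (next_arm A) k.-1).
Proof.
move=> k0i; have /andP[k0 ki] := k0i.
have k1i : (k.-1 <= i)%N by rewrite (leq_trans (leq_pred _)).
have d0 := sec_det_gt0 R A.
have [aP bP abP] := sec_arm_succ A k0i.
have al0 := arm_len_gt0 A k0i; have be0 := arm_len_gt0 (next_arm A) k0i.
have bd0 := arm_len_step_gt0 (next_arm A) k0i.
have be1 := arm_len_ge0 (next_arm A) k.-1.
have sa0 : 0 < sec_a A (arm_pos A k.+1) by apply: lt_le_trans aP; exact: mulr_gt0.
have turn m : (m <= i)%N ->
    orient (arm_pos A k) (arm_pos A k.+1) (arm_pos (next_arm A) m) =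
    (sec_a A (arm_pos A k.+1) - arm_len A k * sec_det A) * arm_len (next_arm A) m
    + sec_b A (arm_pos A k.+1) * arm_len A k.
  move=> mi.
  rewrite (arm_posE A ki) (arm_posE (next_arm A) mi).
  by move: (arm_pos _ _) => P; rewrite /orient /sec_det /sec_a /sec_b /=; ring.
have turn0 : 0 < orient (arm_pos A k) (arm_pos A k.+1) (arm_pos (next_arm A) k).
  rewrite turn//; case: eqP abP => _ abP.
    apply: ltr_wpDl; last exact: mulr_gt0.
    by apply: mulr_ge0; [rewrite subr_ge0|exact: ltW].
  apply: ltr_wpDr; first by apply: mulr_ge0 => //; exact: ltW.
  by apply: mulr_gt0 => //; rewrite subr_gt0.
split=> //.
- by rewrite -orient_rot orient_next//; exact: mulr_gt0.
- by rewrite orient_next// sec_a_arm// !mulr_gt0.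
- rewrite -orient_rot turn//; case: eqP abP => [_|/eqP kNi] abP.
    left; apply: ltr_wpDl; last exact: mulr_gt0.
    by apply: mulr_ge0; rewrite ?subr_ge0.
  have [k1|k1] := eqVneq k 1%N; last first.
    left; apply: ltr_wpDr; first by apply: mulr_ge0 => //; exact: ltW.
    apply: mulr_gt0; first by rewrite subr_gt0.
    by rewrite arm_len_gt0// k1i andbT; case: (k) k0 k1 => [|[]].
  right; exists (arm_len A k / arm_len A k.+1).
  have kSi : (k < i)%N by rewrite ltn_neqAle kNi.
  have lt : arm_len A k < arm_len A k.+1 by rewrite arm_len_lt// ltnSn.
  have alS : 0 < arm_len A k.+1 by exact: lt_trans lt.
  split; first exact: divr_gt0.
    by rewrite ltr_pdivrMr// mul1r.
  rewrite k1 arm_pos0 /= !subr0 !add0r -k1 !arm_posE//=.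
  by congr (_, _); field; rewrite gt_eqF.
Qed.

End Positions.


(** * The faces *)

(** A test by one coordinate that works next to flat corners, where the strict turns required by
    [segment_side] fail. *)
Lemma segment_of_fst (R : realType) (p q a : R * R) :
  orient p q a = 0 -> p.1 < q.1 -> p.1 <= a.1 <= q.1 -> segment p q a.
Proof.
move=> pqa pq /andP[pa aq]; apply/segmentP.
have d0 : 0 < q.1 - p.1 by rewrite subr_gt0.
exists ((a.1 - p.1) / (q.1 - p.1)); split.
- by rewrite divr_ge0// ?subr_ge0// ltW.
- by rewrite ler_pdivrMr// mul1r lerB.
- rewrite [LHS]surjective_pairing; congr (_, _).
    by rewrite divfK ?gt_eqF// subrKC.
  move: pqa; rewrite /orient => /eqP; rewrite subr_eq0 => /eqP e.
  by rewrite mulrAC [_ * (q.2 - _)]mulrC -e mulrAC divff ?gt_eqF// mul1r subrKC.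
Qed.

Lemma segment_of_snd (R : realType) (p q a : R * R) :
  orient p q a = 0 -> p.2 < q.2 -> p.2 <= a.2 <= q.2 -> segment p q a.
Proof.
move=> pqa pq /andP[pa aq]; apply/segmentP.
have d0 : 0 < q.2 - p.2 by rewrite subr_gt0.
exists ((a.2 - p.2) / (q.2 - p.2)); split.
- by rewrite divr_ge0// ?subr_ge0// ltW.
- by rewrite ler_pdivrMr// mul1r lerB.
- rewrite [LHS]surjective_pairing; congr (_, _); last first.
    by rewrite divfK ?gt_eqF// subrKC.
  move: pqa; rewrite /orient => /eqP; rewrite subr_eq0 => /eqP e.
  by rewrite mulrAC [_ * (q.1 - _)]mulrC e mulrAC divff ?gt_eqF// mul1r subrKC.
Qed.

Lemma connected_halfplane (R : realType) (f : R * R -> R) :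
  affine f -> [set p | f p < 0] !=set0 -> connected [set p | f p < 0].
Proof.
move=> af [c fc]; apply: (@connected_star _ _ c) => // a fa b.
rewrite /= in fc fa *; rewrite -oppr_gt0 in fc; rewrite -oppr_gt0 in fa.
rewrite -oppr_gt0; exact: (segment_affine_gt0 (affine_opp af) fc fa).
Qed.

(** * The outer hexagon *)

Section Faces.
Variables (R : realType) (i : nat).
Hypothesis i_gt0 : (0 < i)%N.
Implicit Types (A B : arm) (k m : nat) (p : R * R).

Let i1 : 1 <= i%:R :> R. Proof. by rewrite ler1n. Qed.

Local Notation pos := (arm_pos R i).

Definition cell A k : seq (R * R) :=
  [:: pos A k; pos A k.+1; pos (next_arm A) k; pos (next_arm A) k.-1].

Definition hexagon : seq (R * R) :=
  [:: pos Top i.+1; pos Left i; pos Left i.+1;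
      pos Right i; pos Right i.+1; pos Top i].

Lemma sides_hexagon u : u \in sides hexagon <->
  exists A, u = (pos A i, pos A i.+1) \/ u = (pos A i.+1, pos (next_arm A) i).
Proof.
rewrite /sides /= !inE; split.
  do ?[case/orP]; move/eqP->;
  [exists Top|exists Left|exists Left|exists Right|exists Right|exists Top];
  by [left|right].
by move=> [[] []->]; rewrite eqxx ?orbT.
Qed.

Lemma region_hexagon p : region hexagon p <-> forall A,
  0 <= orient (pos A i) (pos A i.+1) p /\
  0 <= orient (pos A i.+1) (pos (next_arm A) i) p.
Proof.
split=> [H A|H u /sides_hexagon[A [->|->]]]; try by have [] := H A.
by split; [apply: (H (_, _))|apply: (H (_, _))]; apply/sides_hexagon; exists A;
  [left|right].
Qed.

Lemma open_region_hexagon p : open_region hexagon p <-> forall A,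
  0 < orient (pos A i) (pos A i.+1) p /\
  0 < orient (pos A i.+1) (pos (next_arm A) i) p.
Proof.
split=> [H A|H u /sides_hexagon[A [->|->]]]; try by have [] := H A.
by split; [apply: (H (_, _))|apply: (H (_, _))]; apply/sides_hexagon; exists A;
  [left|right].
Qed.

Let posS A : pos A i.+1 = match A with
       | Top => (-1, i%:R + 1)
       | Left => (- i%:R, - i%:R - 1)
       | Right => (i%:R + 2, - i%:R - 1)
       end.
Proof. by rewrite /arm_pos ltnn. Qed.

Let posi A : pos A i = match A with
       | Top => (0, i%:R)
       | Left => (- i%:R, - i%:R)
       | Right => (i%:R + 1, - i%:R - 1)
       end.
Proof. by rewrite /arm_pos leqnn; case: A => /=; rewrite ?eqxx; congr (_, _) => /=; ring. Qed.

Lemma hexagon_along A p : orient (pos A i) (pos A i.+1) p = match A with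
  | Top => i%:R - p.1 - p.2
  | Left => p.1 + i%:R
  | Right => p.2 + i%:R + 1 end.
Proof. by rewrite posS posi /orient; case: A => /=; ring. Qed.

Lemma hexagon_across A p : orient (pos A i.+1) (pos (next_arm A) i) p = match A with
  | Top => (1 - i%:R) * (p.2 - i%:R - 1) + (2 * i%:R + 1) * (p.1 + 1)
  | Left => (2 * i%:R + 1) * (p.2 + i%:R + 1)
  | Right => (i%:R + 2) * (i%:R - p.2) - (2 * i%:R + 1) * p.1 end.
Proof. by rewrite posS posi /orient; case: A => /=; ring. Qed.

Lemma arm_pos_hexagon B m : (m <= i.+1)%N -> region hexagon (pos B m).
Proof.
rewrite leq_eqVlt => /predU1P[->|mi]; apply/region_hexagon => A.
  by rewrite hexagon_along hexagon_across posS; have := i1; case: A; case: B => /= ?; split; nra.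
rewrite ltnS in mi; rewrite hexagon_along hexagon_across arm_posE//.
have := arm_len_ge0 R i B m; have := arm_len_le R B mi.
have := i1.
have -> : arm_len R i B i = (if B is Right then i%:R + 1 else i%:R).
  by case: B => //=; rewrite eqxx.
move: (arm_len R i B m) => l.
by case: A; case: B => /= ? ? ?; split; nra.
Qed.

Let n := i%:R : R.

Lemma hexagon_bounds_region : bounds_region hexagon.
Proof.
have n1 : 1 <= n := i1.
apply: bounds_regionI.
- exists (0, 0); apply/open_region_hexagon => A.
  by rewrite hexagon_along hexagon_across; case: A => /=; rewrite -/n; split; nra.
(* The sides along the three arms give x >= -n, y >= -n - 1 and x + y <= n, a triangle within this
   bound. *)
- exists (2 * n + 2) => a /region_hexagon H.
  have [] := H Top; have [] := H Left; have [] := H Right.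
  rewrite !hexagon_along !hexagon_across -/n => h1 _ h2 _ h3 _.
  by split; rewrite ler_norml; apply/andP; split; lra.
- move=> u /sides_hexagon[A uE] c; rewrite !inE => cE.
  have /region_hexagon/(_ A)[] : region hexagon c.
    by move: cE; do ?[case/orP]; move/eqP->; apply: arm_pos_hexagon; rewrite ?leqnSn.
  by case: uE => ->.
move=> a u /region_hexagon H uS u0.
suff [A aA] : exists A, segment (pos A i) (pos A i.+1) a \/
    segment (pos A i.+1) (pos (next_arm A) i) a.
  case: aA => aA; [exists (pos A i, pos A i.+1)|exists (pos A i.+1, pos (next_arm A) i)] => //;
  by apply/sides_hexagon; exists A; first [by left|by right].
have [+ +] := H Top; have [+ +] := H Left; have [+ +] := H Right.
rewrite !hexagon_along !hexagon_across -/n => h1 h2 h3 h4 h5 h6.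
have topL : orient (pos Top i.+1) (pos Left i) a = 0 -> - n <= a.2 ->
    segment (pos Top i.+1) (pos Left i) a.
  move=> e ay; rewrite segment_sym; apply: segment_of_snd.
  - by rewrite orient_swap e oppr0.
  - by rewrite posi posS /= -/n; lra.
  - rewrite posi posS /= -/n ay /=.
    by rewrite (hexagon_across Top) -/n in e; nra.
have leftL : a.1 = - n -> a.2 <= - n -> segment (pos Left i) (pos Left i.+1) a.
  move=> e ay; rewrite segment_sym; apply: segment_of_snd.
  - by rewrite orient_swap hexagon_along -/n e addNr oppr0.
  - by rewrite posi posS /= -/n; lra.
  - by rewrite posi posS /= -/n ay andbT; lra.
have topT : n - a.1 - a.2 = 0 -> a.1 <= 0 -> segment (pos Top i) (pos Top i.+1) a.
  move=> e ax; rewrite segment_sym; apply: segment_of_fst.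
  - by rewrite orient_swap hexagon_along -/n e oppr0.
  - by rewrite posi posS /= -/n; lra.
  - by rewrite posi posS /= -/n ax andbT; nra.
have rightT : orient (pos Right i.+1) (pos Top i) a = 0 -> 0 <= a.1 ->
    segment (pos Right i.+1) (pos Top i) a.
  move=> e ax; rewrite segment_sym; apply: segment_of_fst.
  - by rewrite orient_swap e oppr0.
  - by rewrite posi posS /= -/n; lra.
  - rewrite posi posS /= -/n ax /=.
    by rewrite (hexagon_across Right) -/n in e; nra.
(* The two sides meeting at r_i both lie on the line y = -n - 1; the abscissa n + 1 of r_i tells
   them apart. *)
have bottom : a.2 + n + 1 = 0 -> exists A, segment (pos A i) (pos A i.+1) a \/
    segment (pos A i.+1) (pos (next_arm A) i) a.
  move=> e; have [ax|/ltW ax] := leP a.1 (n + 1).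
    exists Left; right; apply: segment_of_fst.
    + by rewrite (hexagon_across Left) -/n e mulr0.
    + by rewrite posi posS /= -/n; lra.
    + by rewrite posi posS /= -/n ax andbT; lra.
  exists Right; left; apply: segment_of_fst.
  + by rewrite hexagon_along -/n e.
  + by rewrite posi posS /= -/n; lra.
  + by rewrite posi posS /= -/n ax /=; nra.
(* For n = 1 the two sides at t_1 are collinear, and so are those at l_1: comparing the abscissa
   with 0, or the ordinate with -n, selects the side. For n > 1 the inequalities of the adjacent
   sides suffice off the bottom line. *)
have [n_eq1|n_neq1] := eqVneq n 1.
  have [A [uE|uE]] := (sides_hexagon _).1 uS;
  rewrite {}uE /= ?hexagon_along ?hexagon_across -/n in u0.
  - case: A u0 => u0; last by apply: bottom.
      have [ax|/ltW ax] := leP a.1 0; first by exists Top; left; exact: topT.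
      by exists Right; right; apply: rightT => //; rewrite hexagon_across -/n n_eq1; lra.
    have [ay|/ltW ay] := leP a.2 (- n); first by exists Left; left; apply: leftL; lra.
    by exists Top; right; apply: topL => //; rewrite hexagon_across -/n n_eq1; lra.
  - case: A u0 => u0; first 2 last.
    + have [ax|/ltW ax] := leP a.1 0; last first.
        by exists Right; right; apply: rightT => //; rewrite hexagon_across.
      by exists Top; left; apply: topT => //; rewrite n_eq1 in u0 *; lra.
    + have [ay|/ltW ay] := leP a.2 (- n).
        by exists Left; left; apply: leftL => //; rewrite n_eq1 in u0 *; lra.
      by exists Top; right; apply: topL => //; rewrite hexagon_across.
    + by apply: bottom; rewrite n_eq1 in u0 *; lra.
have n_gt1 : 1 < n by rewrite lt_neqAle eq_sym n_neq1.
have [A [uE|uE]] := (sides_hexagon _).1 uS;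
  rewrite {}uE /= ?hexagon_along ?hexagon_across -/n in u0.
- case: A u0 => u0; last by apply: bottom.
    by exists Top; left; apply: topT => //; nra.
  by exists Left; left; apply: leftL; [lra|nra].
- case: A u0 => u0.
  + by exists Top; right; apply: topL; [rewrite hexagon_across|nra].
  + by apply: bottom; nra.
  + by exists Right; right; apply: rightT; [rewrite hexagon_across|nra].
Qed.

End Faces.


Lemma next_armP (A B : arm) : [\/ B = A, B = next_arm A | A = next_arm B].
Proof. by case: A; case: B; first [by apply: Or31|by apply: Or32|by apply: Or33]. Qed.

Lemma fst_le_norm (R : realType) (p : R * R) : p.1 <= `|p|.
Proof. by rewrite (le_trans (ler_norm _))// {2}/Num.norm /= le_max lexx. Qed.

(** * Cells and outer region as the faces of the drawing *)

Section Cells.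
Variables (R : realType) (i : nat).
Hypothesis i_gt0 : (0 < i)%N.
Implicit Types (A B : arm) (k m : nat) (p : R * R).

Let i1 : 1 <= i%:R :> R. Proof. by rewrite ler1n. Qed.

Local Notation pos := (arm_pos R i).
Local Notation cell := (cell R i).
Local Notation hexagon := (hexagon R i).

Lemma cell_bounds_region A k : (0 < k <= i)%N -> bounds_region (cell A k).
Proof. by move=> ki; apply/quad_bounds_region/cell_convex. Qed.

Lemma cell_affine_ge0 (f : R * R -> R) A k p : (0 < k <= i)%N -> affine f ->
  region (cell A k) p -> 0 <= f (pos A k) -> 0 <= f (pos A k.+1) ->
  0 <= f (pos (next_arm A) k) -> 0 <= f (pos (next_arm A) k.-1) -> 0 <= f p.
Proof.
by move=> ki af kp; apply: (quad_affine_ge0 af _ kp); apply: cell_convex.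
Qed.

Lemma cell_sub_hexagon A k : (0 < k <= i)%N ->
  region (cell A k) `<=` region hexagon.
Proof.
move=> ki p kp u uS; have /andP[k0 ki'] := ki.
apply: (cell_affine_ge0 ki (affine_orient _ _) kp); apply: arm_pos_hexagon uS => //.
- exact: leqW.
- exact: leqW.
- by rewrite (leq_trans (leq_pred _))// leqW.
Qed.

Lemma sec_a_next_le0 A k : (k <= i.+1)%N -> sec_a A (pos (next_arm A) k) <= 0.
Proof.
rewrite leq_eqVlt => /predU1P[->|ki]; first exact/ltW/sec_a_next_top.
by rewrite sec_a_next.
Qed.

Lemma sec_a_prev_le0 A k : (k <= i)%N ->
  sec_a A (pos (next_arm (next_arm A)) k) <= 0.
Proof.
case: k => [|k] ki; first by rewrite arm_pos0// /sec_a !mul0r subrr.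
by apply/ltW/sec_a_prev; rewrite ?ki.
Qed.

(** With three sectors, any two are adjacent, and the line of their common arm separates their
    cells. Within a sector, the outer side of the lower cell does. *)
Lemma open_cell_disjoint A B k m p : (0 < k <= i)%N -> (0 < m <= i)%N ->
  open_region (cell A k) p -> open_region (cell B m) p -> A = B /\ k = m.
Proof.
have sector (C : arm) j l : (0 < j <= i)%N -> (0 < l <= i)%N ->
    open_region (cell C j) p -> open_region (cell (next_arm C) l) p -> False.
  move=> ji li /open_region4[_ _ + _] /open_region_sub lp.
  have /andP[j0 ji'] := ji; have /andP[l0 li'] := li.
  rewrite orient_next ?(leq_trans (leq_pred _))// pmulr_rgt0; last exact: arm_len_step_gt0.
  apply/negP; rewrite -leNgt -oppr_ge0.
  apply: (cell_affine_ge0 li (affine_opp (affine_sec_a R C)) lp); rewrite oppr_ge0.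
  - by apply: sec_a_next_le0; rewrite leqW.
  - exact: sec_a_next_le0.
  - exact: sec_a_prev_le0.
  - by apply: sec_a_prev_le0; rewrite (leq_trans (leq_pred _)).
have level (C : arm) j l : (0 < j <= i)%N -> (0 < l <= i)%N -> (j < l)%N ->
    open_region (cell C j) p -> open_region (cell C l) p -> False.
  move=> ji li jl /open_region4[_ + _ _] /open_region_sub lp.
  have /andP[j0 ji'] := ji; have /andP[l0 li'] := li.
  have jlti := leq_trans jl li'.
  apply/negP; rewrite -leNgt -oppr_ge0.
  apply: (cell_affine_ge0 li (affine_opp (affine_orient _ _)) lp); rewrite oppr_ge0.
  - by apply: orient_across_arm_le0; rewrite // jl leqW.
  - by apply: orient_across_arm_le0; rewrite // ltnW.
  - by apply: orient_across_next_le0; rewrite // li' ltnW.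
  - apply: orient_across_next_le0 => //; rewrite (leq_trans (leq_pred _))// andbT.
    by case: (l) jl.
move=> ki mi kp mp; have [AB|AB|AB] := next_armP A B.
- subst B; split=> //; have [km|mk|//] := ltngtP k m.
    by case: (level _ _ _ ki mi km kp mp).
  by case: (level _ _ _ mi ki mk mp kp).
- by case: (sector A k m ki mi kp); rewrite -AB.
- by case: (sector B m k mi ki mp); rewrite -AB.
Qed.

(** A closed cell is the closure of its interior, and an open set that meets a closure meets the set
    itself. *)
Lemma open_cell_region A B k m p : (0 < k <= i)%N -> (0 < m <= i)%N ->
  open_region (cell A k) p -> region (cell B m) p -> A = B /\ k = m.
Proof.
move=> ki mi kp; have [ne _ _] := cell_bounds_region B mi.
rewrite -closure_open_region//.
move=> /(_ (open_region (cell A k))); case.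
  by rewrite nbhsE /=; exists (open_region (cell A k)) => //; split => //; exact: open_open_region.
by move=> q [mq kq]; exact: open_cell_disjoint kq mq.
Qed.

(** A discrete intermediate value argument in the sector of [p]. The form of the line A_k B_(k-1),
    with [B = next_arm A], is nonpositive at [p] for [k = 1], where this line is the arm [A]; the
    cell is found where the sign changes, or at level i, where a side of the hexagon closes it. *)
Lemma cells_cover p : region hexagon p ->
  exists A k, (0 < k <= i)%N /\ region (cell A k) p.
Proof.
move=> /region_hexagon H; have [A [a0 b0]] := sector_cover p.
have level j : (0 < j <= i)%N -> exists k, [/\ (0 < k <= j)%N,
    orient (pos A k) (pos (next_arm A) k.-1) p <= 0 &
    k = j \/ 0 <= orient (pos A k.+1) (pos (next_arm A) k) p].
  elim: j => // -[_ ji|j IH /andP[_ ji]].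
    exists 1%N; split=> //; last by left.
    rewrite orient_across// arm_len0// mulr0 !mul0r subrr sub0r oppr_le0.
    by rewrite mulr_ge0// arm_len_ge0.
  have [le|/ltW ge] := leP (orient (pos A j.+2) (pos (next_arm A) j.+1) p) 0.
    by exists j.+2; rewrite leqnn; split=> //; left.
  have [|k [/andP[k0 kj] kle kge]] := IH; first exact: ltnW ji.
  exists k; split=> //; first by rewrite k0 leqW.
  by right; case: kge => [->|].
have [|k [/andP[k0 ki] kle kge]] := level i; first by rewrite i_gt0 leqnn.
have k1i : (k.-1 <= i)%N by rewrite (leq_trans (leq_pred _)).
exists A, k; rewrite k0 ki; split=> //; apply/region4; split.
- have [->|ki'] := eqVneq k i; first by have [] := H A.
  have {}ki' : (k < i)%N by rewrite ltn_neqAle ki'.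
  by rewrite orient_along// mulr_ge0// subr_ge0 ltW// arm_len_lt// ltnSn.
- by case: kge => // ->; have [] := H A.
- rewrite orient_next// mulr_ge0//; apply/ltW/arm_len_step_gt0 => //.
  by rewrite k0.
- by rewrite orient_swap oppr_ge0.
Qed.

Lemma Gamma'_drawingP p : drawing (graphH i) (Gamma' R i) p <->
  exists A k,
    (k <= i)%N /\ segment (pos A k) (pos A k.+1) p \/
    (0 < k <= i)%N /\ segment (pos A k.+1) (pos (next_arm A) k) p.
Proof.
split.
  case=> [[v /(mem_vertices _ i_gt0)[A [k [ki ->]]] ->]|].
    rewrite Gamma'_arm_vertex//; move: ki; rewrite leq_eqVlt => /predU1P[->|ki].
      by exists A, i; left; split=> //; exact: segment_r.
    by exists A, k; left; split=> //; exact: segment_l.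
  move=> [e /(mem_edges _ i_gt0)[A|A k /andP[k0 ki]|A k /andP[k0 ki]]] /=;
    rewrite !Gamma'_arm_vertex ?ltnS ?leqW//.
  - by exists A, 0%N; left.
  - by rewrite segment_sym; exists A, k; left.
  - by rewrite segment_sym; exists A, k; right; rewrite k0.
move=> [A [k [[ki]|[ki]]]] kp; right.
  case: k ki kp => [_|k ki] kp.
    exists (arm_vertex A 0, arm_vertex A 1); first by apply/mem_edges => //; exact: Spoke.
    by rewrite !Gamma'_arm_vertex.
  exists (arm_vertex A k.+2, arm_vertex A k.+1).
    by apply/mem_edges => //; exact: Along.
  by rewrite !Gamma'_arm_vertex ?ltnS ?(ltnW ki)// segment_sym.
exists (arm_vertex (next_arm A) k, arm_vertex A k.+1).
  by apply/mem_edges => //; exact: Across.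
have /andP[_ ki'] := ki.
by rewrite !Gamma'_arm_vertex ?ltnS ?leqW// segment_sym.
Qed.

(** Every edge is a side of a cell: the outer edges belong to cells of level i, and a spoke is the
    third side of the innermost cell of the sector before its arm. *)
Lemma drawing_cells p : drawing (graphH i) (Gamma' R i) p <->
  exists A k, (0 < k <= i)%N /\ polygon (cell A k) p.
Proof.
split=> [/Gamma'_drawingP[A [k [[ki kp]|[ki kp]]]]|].
- case: k ki kp => [|k] ki kp.
    have [B AB] : exists B, A = next_arm B.
      by case: A {kp}; [exists Right|exists Top|exists Left].
    subst A.
    exists B, 1%N; split=> //; apply/polygon4/Or43.
    by rewrite segment_sym.
  by exists A, k.+1; split=> //; apply/polygon4/Or41.
- by exists A, k; split=> //; apply/polygon4/Or42.
move=> [A [k [ki /polygon4 kp]]]; apply/Gamma'_drawingP; have /andP[k0 ki'] := ki.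
case: kp => kp.
- by exists A, k; left.
- by exists A, k; right.
- exists (next_arm A), k.-1; left; rewrite prednK// segment_sym.
  by rewrite (leq_trans (leq_pred _)).
- case: k k0 ki ki' kp => // -[_ _ _ /= kp|k _ ki ki' kp].
    exists A, 0%N; left; split=> //.
    by move: kp; rewrite !arm_pos0.
  by exists A, k.+1; right; split; [exact: ltnW|rewrite segment_sym].
Qed.

Definition faces : set (set (R * R)) :=
  [set U | (exists A k, (0 < k <= i)%N /\ U = open_region (cell A k)) \/
           U = ~` region hexagon].

Lemma drawing_complement :
  ~` drawing (graphH i) (Gamma' R i) = \bigcup_(U in faces) U.
Proof.
apply/seteqP; split=> [p nD|p [U [[A [k [ki ->]]]|->] Up]].
- have [Hp|nHp] := pselect (region hexagon p); last by exists (~` region hexagon) => //; right.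
  have [A [k [ki kp]]] := cells_cover Hp.
  exists (open_region (cell A k)); first by left; exists A, k.
  apply: contrapT => nkp; apply: nD; apply/drawing_cells; exists A, k; split=> //.
  by have [_ _ ->] := cell_bounds_region A ki; rewrite -regionD.
- move=> /drawing_cells[B [m [mi mp]]].
  have bm := cell_bounds_region B mi.
  have [AB km] := open_cell_region ki mi Up (polygon_sub_region bm mp).
  subst B m; move: mp; have [_ _ ->] := bm.
  by rewrite -regionD => -[].
- move=> /drawing_cells[B [m [mi mp]]]; apply: Up.
  by apply: (cell_sub_hexagon mi); apply: polygon_sub_region mp; exact: cell_bounds_region.
Qed.

(** Six sides give only five half-planes, those at r_i being collinear. The point (-n - 1, 3 n + 1)
    lies in the first three, (-n - 1, -n - 2) links the third to the fourth, and (3 (n + 2), -n - 2)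
    the fourth to the fifth. *)
Lemma connected_outer : connected (~` region hexagon).
Proof.
have n1 := i1; set n := i%:R in n1.
pose f1 p := n - p.1 - p.2.
pose f2 p := (1 - n) * (p.2 - n - 1) + (2 * n + 1) * (p.1 + 1).
pose f3 p := p.1 + n.
pose f4 p := p.2 + n + 1.
pose f5 p := (n + 2) * (n - p.2) - (2 * n + 1) * p.1.
have a1 : affine f1 by exists (-1), (-1), n => p; rewrite /f1; ring.
have a2 : affine f2.
  by exists (2 * n + 1), (1 - n), ((1 - n) * (- n - 1) + (2 * n + 1)) => p; rewrite /f2; ring.
have a3 : affine f3 by exists 1, 0, n => p; rewrite /f3; ring.
have a4 : affine f4 by exists 0, 1, (n + 1) => p; rewrite /f4; ring.
have a5 : affine f5.
  by exists (- (2 * n + 1)), (- (n + 2)), ((n + 2) * n) => p; rewrite /f5; ring.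
have -> : ~` region hexagon = [set p | f1 p < 0] `|` [set p | f2 p < 0] `|`
    [set p | f3 p < 0] `|` [set p | f4 p < 0] `|` [set p | f5 p < 0].
  apply/seteqP; split=> p.
    move=> nH; apply: contrapT => /not_orP[/not_orP[/not_orP[/not_orP[]]]] /=.
    move=> /negP + /negP + /negP + /negP + /negP; rewrite -!leNgt => h1 h2 h3 h4 h5.
    apply: nH; apply/region_hexagon => // A; rewrite hexagon_along// hexagon_across//.
    case: A; split=> //.
    by rewrite mulr_ge0//; lra.
  move=> + /region_hexagon H.
  have [] := H Top; have [] := H Left; have [] := H Right.
  rewrite !hexagon_along// !hexagon_across// => h1 h2 h3 h4 h5 h6.
  by case=> [[[[]|]|]|] /=; apply/negP; rewrite -leNgt.
have c1 : f1 (- n - 1, 3 * n + 1) < 0 by rewrite /f1 /=; lra.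
have c2 : f2 (- n - 1, 3 * n + 1) < 0 by rewrite /f2 /=; nra.
have c3 : f3 (- n - 1, 3 * n + 1) < 0 by rewrite /f3 /=; lra.
have c3' : f3 (- n - 1, - n - 2) < 0 by rewrite /f3 /=; lra.
have c4 : f4 (- n - 1, - n - 2) < 0 by rewrite /f4 /=; lra.
have c4' : f4 (3 * (n + 2), - n - 2) < 0 by rewrite /f4 /=; lra.
have c5 : f5 (3 * (n + 2), - n - 2) < 0 by rewrite /f5 /=; nra.
apply: connectedU.
- by exists (3 * (n + 2), - n - 2); split => //; right.
- apply: connectedU.
  + by exists (- n - 1, - n - 2); split => //; right.
  + apply: connectedU.
    * by exists (- n - 1, 3 * n + 1); split => //; right.
    * apply: connectedU; first by exists (- n - 1, 3 * n + 1).
        by apply: connected_halfplane => //; exists (- n - 1, 3 * n + 1).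
      by apply: connected_halfplane => //; exists (- n - 1, 3 * n + 1).
    * by apply: connected_halfplane => //; exists (- n - 1, 3 * n + 1).
  + by apply: connected_halfplane => //; exists (- n - 1, - n - 2).
- by apply: connected_halfplane => //; exists (3 * (n + 2), - n - 2).
Qed.

Lemma unbounded_outer : ~ bounded_set (~` region hexagon).
Proof.
move=> [M [_ /(_ (`|M| + i%:R + 2))]]; have n1 := i1; have M0 := ler_norm M.
have /[swap]/[apply] : M < `|M| + i%:R + 2 by lra.
have M0' := normr_ge0 M.
move=> /(_ (`|M| + i%:R + 3, `|M| + i%:R + 3)) /= H.
have : ~ region hexagon (`|M| + i%:R + 3, `|M| + i%:R + 3).
  by move=> /region_hexagon /(_ Top)[]; rewrite hexagon_along//= => ? _; lra.
move=> /H; move/(le_trans (fst_le_norm _)) => /=; lra.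
Qed.

Lemma faceP F : is_face (drawing (graphH i) (Gamma' R i)) F <-> faces F.
Proof.
rewrite /is_face; apply: components_of_partition.
- move=> U [[A [k [ki ->]]]|->].
    have [ne _ _] := cell_bounds_region A ki.
    by split=> //; [exact: open_open_region|exact: connected_open_region].
  split; [exact/closed_openC/closed_region|exact: connected_outer|].
  apply: contrapT => /nonemptyPn H; apply: unbounded_outer; rewrite H.
  by exists 0; split=> // x _ a.
- move=> U V [[A [k [ki ->]]]|->] [[B [m [mi ->]]]|->] // [p [Up Vp]].
  + by have [-> ->] := open_cell_disjoint ki mi Up Vp.
  + by exfalso; apply: Vp; exact: (cell_sub_hexagon ki (open_region_sub Up)).
  + by exfalso; apply: Up; exact: (cell_sub_hexagon mi (open_region_sub Vp)).
- exact: drawing_complement.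
Qed.

Lemma bounded_open_cell A k : (0 < k <= i)%N -> bounded_set (open_region (cell A k)).
Proof.
move=> ki; apply: sub_boundedr (bounded_region (cell_bounds_region A ki)).
by move=> P kP a /open_region_sub; exact: kP.
Qed.

End Cells.


(** * Planarity *)

Section Planarity.
Variables (R : realType) (i : nat).
Hypothesis i_gt0 : (0 < i)%N.
Implicit Types (A B C : arm) (k m : nat) (p q : R * R).

Local Notation pos := (arm_pos R i).

Lemma sec_b_next_arm A p : sec_b (next_arm A) p = - sec_a A p.
Proof. by rewrite /sec_a /sec_b; ring. Qed.

Lemma prev_arm A : next_arm (next_arm (next_arm A)) = A.
Proof. by case: A. Qed.

Lemma arm_pos_inj A B k m : (k <= i.+1)%N -> (m <= i.+1)%N ->
  pos A k = pos B m -> arm_vertex A k = arm_vertex B m.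
Proof.
have same C j l : (j < l <= i.+1)%N -> pos C j = pos C l -> False.
  move=> /andP[jl]; rewrite leq_eqVlt => /predU1P[lE|li] E.
    have := sec_b_top R i_gt0 C; rewrite -lE -E sec_b_arm ?ltxx//.
    by rewrite -ltnS -lE.
  have := @arm_len_lt R i C j l; rewrite jl => /(_ li).
  rewrite -(ltr_pM2r (sec_det_gt0 R C)) -!sec_a_arm ?E ?ltxx//.
  exact: ltnW (leq_trans jl li).
have next C j l : (j <= i.+1)%N -> (l <= i.+1)%N ->
    pos C j = pos (next_arm C) l -> j = 0%N /\ l = 0%N.
  case: j => [|j] ji li E; last first.
    have := @sec_a_arm_gt0 R i i_gt0 C j.+1; rewrite E => /(_ ji).
    by rewrite ltNge sec_a_next_le0.
  case: l li E => // l li; rewrite arm_pos0// => E.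
  have := @sec_a_arm_gt0 R i i_gt0 (next_arm C) l.+1; rewrite -E => /(_ li).
  by rewrite /sec_a !mul0r subrr ltxx.
move=> ki mi E; have [AB|AB|AB] := next_armP A B; subst.
- have [km|mk|->//] := ltngtP k m.
    by case: (same A k m); rewrite ?km.
  by case: (same A m k); rewrite ?mk.
- by have [-> ->] := next _ _ _ ki mi E.
- by have [-> ->] := next _ _ _ mi ki (esym E).
Qed.

(** Each form is nonnegative at both end-points and positive at one, so it can vanish on the segment
    only at an end-point: anything outside the open sector meets the segment at most there. *)
Definition in_sector A p q : Prop :=
  [/\ 0 <= sec_a A p, 0 <= sec_a A q & 0 < sec_a A p + sec_a A q] /\
  [/\ 0 <= sec_b A p, 0 <= sec_b A q & 0 < sec_b A p + sec_b A q].

Lemma along_in_sector A : in_sector A (pos A i) (pos A i.+1).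
Proof.
have a0 := sec_a_arm_ge0 R A (leqnSn i).
have a1 : 0 < sec_a A (pos A i.+1) by rewrite sec_a_arm_gt0// leqnn.
have b1 := sec_b_top R i_gt0 A.
have b0 : sec_b A (pos A i) = 0 by rewrite sec_b_arm.
by split; split; rewrite ?b0 ?add0r//;
  first [exact: ltW|exact: ltr_wpDl].
Qed.

Lemma across_in_sector A k : (0 < k <= i)%N ->
  in_sector A (pos A k.+1) (pos (next_arm A) k).
Proof.
move=> ki; have /andP[k0 ki'] := ki.
have a1 : 0 < sec_a A (pos A k.+1) by rewrite sec_a_arm_gt0.
have b0 : 0 <= sec_b A (pos A k.+1) by rewrite sec_b_arm_ge0.
have b1 : 0 < sec_b A (pos (next_arm A) k) by rewrite sec_b_next_gt0.
by split; split; rewrite ?sec_a_next ?addr0//;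
  first [exact: ltW|exact: ltr_wpDl].
Qed.

Lemma touching_endpoint (f : R * R -> R) p q a : affine f ->
  0 <= f p -> 0 <= f q -> 0 < f p + f q -> f a <= 0 ->
  segment p q a -> a = p \/ a = q.
Proof.
move=> af p0 q0 pq a0 pqa.
exact: (separated_segments af p0 q0 pq a0 a0 pqa (segment_l _ _)).
Qed.

Lemma in_sector_sec_a A p q a : in_sector A p q -> sec_a A a <= 0 ->
  segment p q a -> a = p \/ a = q.
Proof.
by move=> [[p0 q0 pq] _] a0; apply: touching_endpoint a0 => //; exact: affine_sec_a.
Qed.

Lemma in_sector_sec_b A p q a : in_sector A p q -> sec_b A a <= 0 ->
  segment p q a -> a = p \/ a = q.
Proof.
by move=> [_ [p0 q0 pq]] a0; apply: touching_endpoint a0 => //; exact: affine_sec_b.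
Qed.

(** Only A_(i+1) lies strictly inside the sector after [A]; at every other vertex [sec_a] or [sec_b]
    is nonpositive. *)
Lemma in_sector_vertex A C m p q : (m <= i.+1)%N -> in_sector A p q ->
  segment p q (pos C m) ->
  [\/ pos C m = p, pos C m = q | C = A /\ m = i.+1].
Proof.
move=> mi Apq pqC.
have done_ : pos C m = p \/ pos C m = q ->
  [\/ pos C m = p, pos C m = q | C = A /\ m = i.+1].
  by case; [exact: Or31|exact: Or32].
have [AB|AB|AB] := next_armP A C.
- subst C; move: mi; rewrite leq_eqVlt => /predU1P[->|mi]; first by apply: Or33.
  by apply: done_; apply: (in_sector_sec_b Apq _ pqC); rewrite sec_b_arm.
- by apply: done_; apply: (in_sector_sec_a Apq _ pqC); rewrite AB sec_a_next_le0.
- move: mi; rewrite leq_eqVlt => /predU1P[mE|mi]; apply: done_.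
    apply: (in_sector_sec_b Apq _ pqC).
    by rewrite AB -[X in sec_b _ (pos X _)]prev_arm mE; exact/ltW/sec_b_prev_top.
  apply: (in_sector_sec_a Apq _ pqC).
  by rewrite AB -[X in sec_a _ (pos X _)]prev_arm sec_a_prev_le0.
Qed.

Lemma vertex_across A k C m : (0 < k <= i)%N -> (m <= i.+1)%N ->
  segment (pos A k.+1) (pos (next_arm A) k) (pos C m) ->
  pos C m = pos A k.+1 \/ pos C m = pos (next_arm A) k.
Proof.
move=> ki mi kC; have /andP[k0 ki'] := ki.
have [->|->|[CA mE]] := in_sector_vertex mi (across_in_sector A ki) kC; [by left|by right|].
subst C m; have [->|kNi] := eqVneq k i; first by left.
have {}kNi : (k < i)%N by rewrite ltn_neqAle kNi.
have lt0 : orient (pos A k.+1) (pos (next_arm A) k) (pos A i.+1) < 0.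
  by apply: orient_across_arm_lt0; rewrite ?k0// ltnS kNi.
suff e : orient (pos A k.+1) (pos (next_arm A) k) (pos A i.+1) = 0.
  by rewrite e ltxx in lt0.
by apply: (segment_affine_eq0 (affine_orient _ _) _ _ kC); rewrite /orient; ring.
Qed.

Lemma along_sec_b A k p : (k < i)%N -> segment (pos A k) (pos A k.+1) p ->
  sec_b A p = 0.
Proof.
move=> ki; apply: (segment_affine_eq0 (affine_sec_b R A)); rewrite sec_b_arm//.
exact: ltnW.
Qed.

Lemma affine_subc (f : R * R -> R) c : affine f -> affine (fun p => f p - c).
Proof.
by move=> [x [y [z fE]]]; exists x, y, (z - c) => p; rewrite fE; ring.
Qed.

Lemma along_sec_a A k p : (k < i)%N -> segment (pos A k) (pos A k.+1) p ->
  arm_len R i A k * sec_det R A <= sec_a A p <= arm_len R i A k.+1 * sec_det R A.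
Proof.
move=> ki kp.
have lt : arm_len R i A k * sec_det R A <= arm_len R i A k.+1 * sec_det R A.
  apply: ler_wpM2r; first exact/ltW/sec_det_gt0.
  by apply/ltW/arm_len_lt; rewrite ltnSn.
apply/andP; split; rewrite -subr_ge0.
  have af := affine_subc (arm_len R i A k * sec_det R A) (affine_sec_a R A).
  apply: (segment_affine_ge0 af _ _ kp); rewrite subr_ge0 sec_a_arm//.
  exact: ltnW.
rewrite -opprB.
have af := affine_opp (affine_subc (arm_len R i A k.+1 * sec_det R A) (affine_sec_a R A)).
apply: (segment_affine_ge0 af _ _ kp); rewrite oppr_ge0 subr_le0 sec_a_arm//.
exact: ltnW.
Qed.

(** For [k < i] the edge lies on the line [sec_b A = 0], whose only vertices are those of the arm
    [A], x_0 counting as one of them; [sec_a] orders them by level. *)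
Lemma vertex_along A k C m : (k <= i)%N -> (m <= i.+1)%N ->
  segment (pos A k) (pos A k.+1) (pos C m) ->
  pos C m = pos A k \/ pos C m = pos A k.+1.
Proof.
move=> ki mi kC.
move: ki kC; rewrite leq_eqVlt => /predU1P[->|ki] kC.
  have [->|->|[CA mE]] := in_sector_vertex mi (along_in_sector A) kC; [by left|by right|].
  by subst; right.
have b0 := along_sec_b ki kC.
have [j ji jE] : exists2 j, (j <= i)%N & pos C m = pos A j.
  case: m mi kC b0 => [|m] mi kC b0; first by exists 0%N => //; rewrite !arm_pos0.
  have [AB|AB|AB] := next_armP A C.
  - subst C; exists m.+1 => //; rewrite -ltnS ltn_neqAle mi andbT; apply/eqP=> mE.
    by have := sec_b_top R i_gt0 A; rewrite -mE b0 ltxx.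
  - subst C; exfalso; move: mi b0; rewrite leq_eqVlt => /predU1P[->|mi] b0.
      by have := sec_b_next_top R i_gt0 A; rewrite b0 ltxx.
    by have := @sec_b_next_gt0 R i i_gt0 A m.+1; rewrite b0 ltxx => /(_ mi).
  - exfalso; move: mi b0; rewrite leq_eqVlt => /predU1P[->|mi] b0.
      by have := sec_b_prev_top R i_gt0 A; rewrite AB prev_arm -AB b0 ltxx.
    have := @sec_b_prev R i i_gt0 A m.+1; rewrite {2}AB prev_arm b0 ltxx => /(_ mi).
    by [].
have := along_sec_a ki kC; rewrite jE sec_a_arm// !ler_pM2r ?(sec_det_gt0 R)// => /andP[kj jk].
have kj' : (k <= j)%N.
  rewrite leqNgt; apply/negP => jltk; move: kj; rewrite leNgt arm_len_lt// jltk.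
  exact: ltnW.
have jk' : (j <= k.+1)%N.
  by rewrite leqNgt; apply/negP => kltj; move: jk; rewrite leNgt arm_len_lt// kltj.
move: jk'; rewrite leq_eqVlt ltnS => /predU1P[->|jk']; [by right|left].
by rewrite (_ : j = k)//; apply/eqP; rewrite eqn_leq kj' jk'.
Qed.

(* The edges are indexed by [b], [A] and [k]: a step along the arm [A] if [b],
   and a step across the sector after [A] otherwise. *)
Definition edge_fst (b : bool) A k : R * R := if b then pos A k else pos A k.+1.

Definition edge_snd (b : bool) A k : R * R :=
  if b then pos A k.+1 else pos (next_arm A) k.

Definition edge_ok (b : bool) k : bool := (k <= i)%N && (b || (0 < k)%N).

Lemma edge_vertex b A k C m : edge_ok b k -> (m <= i.+1)%N ->
  segment (edge_fst b A k) (edge_snd b A k) (pos C m) ->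
  pos C m = edge_fst b A k \/ pos C m = edge_snd b A k.
Proof.
case: b => /andP[ki k0] mi; first exact: vertex_along.
by apply: vertex_across => //; rewrite ki andbT.
Qed.

(** Edges across and the last step of each arm run through an open sector; all other edges are
    contained in an arm. *)
Lemma edge_in_sector b A k : edge_ok b k ->
  in_sector A (edge_fst b A k) (edge_snd b A k) /\ (b -> k = i) \/
  b /\ (k < i)%N.
Proof.
case: b => /andP[ki k0]; last first.
  by left; split=> //; apply: across_in_sector; rewrite ki andbT.
move: ki; rewrite leq_eqVlt => /predU1P[->|ki]; last by right.
by left; split=> //; exact: along_in_sector.
Qed.

(** It suffices to make [p] an end-point of one of the two edges: since no edge passes through a
    foreign vertex, [p] is then an end-point of both. *)
Lemma edge_cross b A k c B m p : edge_ok b k -> edge_ok c m ->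
  segment (edge_fst b A k) (edge_snd b A k) p ->
  segment (edge_fst c B m) (edge_snd c B m) p ->
  [/\ b = c, A = B & k = m] \/
  [\/ p = edge_fst b A k, p = edge_snd b A k, p = edge_fst c B m | p = edge_snd c B m].
Proof.
have or1 u v x y : p = u \/ p = v -> [\/ p = u, p = v, p = x | p = y].
  by case; [exact: Or41|exact: Or42].
have or2 u v x y : p = x \/ p = y -> [\/ p = u, p = v, p = x | p = y].
  by case; [exact: Or43|exact: Or44].
have sector_arm u v C D l : in_sector C u v -> (l < i)%N ->
    segment u v p -> segment (pos D l) (pos D l.+1) p -> p = u \/ p = v.
  move=> Cuv li uvp lp; have li' := ltnW li.
  have [AB|AB|AB] := next_armP C D.
  - by subst; apply: (in_sector_sec_b Cuv _ uvp); rewrite (along_sec_b li lp).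
  - apply: (in_sector_sec_a Cuv _ uvp).
    by rewrite -oppr_ge0 -sec_b_next_arm -AB (along_sec_b li lp).
  - apply: (in_sector_sec_a Cuv _ uvp); rewrite -oppr_ge0.
    apply: (segment_affine_ge0 (affine_opp (affine_sec_a R C)) _ _ lp); rewrite oppr_ge0.
      by rewrite AB -[X in sec_a _ (pos X _)]prev_arm sec_a_prev_le0.
    by rewrite AB -[X in sec_a _ (pos X _)]prev_arm sec_a_prev_le0.
have sector_next u v x y C : in_sector C u v -> in_sector (next_arm C) x y ->
    segment u v p -> segment x y p -> p = u \/ p = v.
  move=> Cuv [_ [x0 y0 _]] uvp xyp; apply: (in_sector_sec_a Cuv _ uvp).
  rewrite -oppr_ge0 -sec_b_next_arm.
  exact: (segment_affine_ge0 (affine_sec_b R _) x0 y0 xyp).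
have arm_same C j l : (j < l)%N -> (l < i)%N ->
    segment (pos C j) (pos C j.+1) p -> segment (pos C l) (pos C l.+1) p ->
    p = pos C l \/ p = pos C l.+1.
  move=> jl li jp lp; have ji := ltn_trans jl li.
  have /andP[_ h1] := along_sec_a ji jp.
  have af := affine_subc (arm_len R i C l * sec_det R C) (affine_sec_a R C).
  have ll : 0 < (arm_len R i C l.+1 - arm_len R i C l) * sec_det R C.
    apply: mulr_gt0; last exact: sec_det_gt0.
    by rewrite subr_gt0 arm_len_lt// ltnSn.
  have jll : arm_len R i C j.+1 * sec_det R C <= arm_len R i C l * sec_det R C.
    apply: ler_wpM2r; first exact/ltW/sec_det_gt0.
    by move: jl; rewrite leq_eqVlt => /predU1P[->//|jl]; apply/ltW/arm_len_lt; rewrite jl ltnW.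
  apply: (touching_endpoint af _ _ _ _ lp); rewrite ?sec_a_arm//; first [exact: ltnW|lra].
have arm_next C j l : (j < i)%N -> (l < i)%N ->
    segment (pos C j) (pos C j.+1) p ->
    segment (pos (next_arm C) l) (pos (next_arm C) l.+1) p ->
    p = pos (next_arm C) l \/ p = pos (next_arm C) l.+1.
  move=> ji li jp lp; have b0 := along_sec_b ji jp; have li' := ltnW li.
  have bS : 0 < sec_b C (pos (next_arm C) l.+1) by apply: sec_b_next_gt0.
  have bl : 0 <= sec_b C (pos (next_arm C) l) by apply: sec_b_next_ge0.
  apply: (touching_endpoint (affine_sec_b R C) _ _ _ _ lp);
    [exact: bl|exact: ltW|exact: ltr_wpDl|by rewrite b0].
have across_level C j u v : (0 < j < i)%N ->
    orient (pos C j.+1) (pos (next_arm C) j) u <= 0 ->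
    orient (pos C j.+1) (pos (next_arm C) j) v <= 0 ->
    orient (pos C j.+1) (pos (next_arm C) j) u +
    orient (pos C j.+1) (pos (next_arm C) j) v < 0 ->
    segment (pos C j.+1) (pos (next_arm C) j) p -> segment u v p -> p = u \/ p = v.
  move=> ji u0 v0 uv0 jp uvp.
  apply: (touching_endpoint (affine_opp (affine_orient (pos C j.+1) (pos (next_arm C) j)))
    _ _ _ _ uvp).
  - by rewrite oppr_ge0.
  - by rewrite oppr_ge0.
  - by rewrite -opprD oppr_gt0.
  - by rewrite oppr_le0 (segment_affine_eq0 (affine_orient _ _) _ _ jp) // /orient; ring.
have across_across C j l : (0 < j < l)%N -> (l <= i)%N ->
    segment (pos C j.+1) (pos (next_arm C) j) p ->
    segment (pos C l.+1) (pos (next_arm C) l) p ->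
    p = pos C l.+1 \/ p = pos (next_arm C) l.
  move=> /andP[j0 jl] li jp lp; have ji := leq_trans jl li.
  have l1 : orient (pos C j.+1) (pos (next_arm C) j) (pos C l.+1) < 0.
    by apply: orient_across_arm_lt0 => //; [rewrite j0|rewrite !ltnS jl].
  have l2 : orient (pos C j.+1) (pos (next_arm C) j) (pos (next_arm C) l) < 0.
    by apply: orient_across_next_lt0 => //; rewrite jl.
  apply: across_level jp lp; [by rewrite j0|exact: ltW|exact: ltW|lra].
have across_along C j : (0 < j <= i)%N ->
    segment (pos C j.+1) (pos (next_arm C) j) p ->
    segment (pos C i) (pos C i.+1) p ->
    [\/ p = pos C j.+1, p = pos (next_arm C) j, p = pos C i | p = pos C i.+1].
  move=> /andP[j0]; rewrite leq_eqVlt => /predU1P[->|ji] jp ip.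
    apply: or1.
    (* At level i the two edges share C_(i+1), and the line of the last step along the arm is the
       separating one. *)
    have pqr : 0 < orient (pos C i) (pos C i.+1) (pos (next_arm C) i).
      by have [] := @cell_convex R i i_gt0 C i; rewrite ?i_gt0 ?leqnn.
    apply: (touching_endpoint (affine_orient (pos C i) (pos C i.+1)) _ _ _ _ jp).
    - by rewrite /orient le_eqVlt; apply/orP; left; apply/eqP; ring.
    - exact: ltW.
    - by rewrite ltr_wpDl// /orient le_eqVlt; apply/orP; left; apply/eqP; ring.
    - by rewrite (segment_affine_eq0 (affine_orient _ _) _ _ ip) // /orient; ring.
  apply: or2.
  have l1 : orient (pos C j.+1) (pos (next_arm C) j) (pos C i.+1) < 0.
    apply: orient_across_arm_lt0 => //; first by rewrite j0.
    by rewrite ltnS ji leqnn.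
  have l2 : orient (pos C j.+1) (pos (next_arm C) j) (pos C i) <= 0.
    by apply: orient_across_arm_le0 => //; rewrite ji leqnSn.
  apply: across_level jp ip; [by rewrite j0|exact: l2|exact: ltW|lra].
move=> bk cm kp mp.
have [[Abk bi]|[bT ki]] := edge_in_sector A bk;
  have [[Bcm ci]|[cT mi]] := edge_in_sector B cm.
- have [AB|AB|AB] := next_armP A B.
  + subst B; move: bk cm; rewrite /edge_ok => /andP[ki k0] /andP[mi m0].
    case: b c k0 m0 kp mp {Abk Bcm} bi ci => -[] /= k0 m0 kp mp bi ci.
    * by left; rewrite bi// ci.
    * have kE := bi isT; subst k; right.
      have := across_along A m; rewrite m0 mi => /(_ isT mp kp).
      by case; [exact: Or43|exact: Or44|exact: Or41|exact: Or42].
    * have mE := ci isT; subst m; right.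
      by have := across_along A k; rewrite k0 ki => /(_ isT kp mp).
    * have [km|mk|->] := ltngtP k m; [right|right|by left].
        by apply: or2; apply: across_across kp mp; rewrite // k0.
      by apply: or1; apply: across_across mp kp; rewrite // m0.
  + by right; apply: or1; apply: sector_next Abk _ kp mp; rewrite -AB.
  + by right; apply: or2; apply: sector_next Bcm _ mp kp; rewrite -AB.
- right; apply: or1; apply: (sector_arm _ _ _ _ _ Abk mi kp).
  by move: mp; rewrite /edge_fst /edge_snd cT /=; apply.
- right; apply: or2; apply: (sector_arm _ _ _ _ _ Bcm ki mp).
  by move: kp; rewrite /edge_fst /edge_snd bT /=; apply.
- case: b bT {bk} kp => // _ kp; case: c cT {cm} mp => // _ mp.
  have [AB|AB|AB] := next_armP A B.
  + subst B; have [km|mk|->] := ltngtP k m; [right|right|by left].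
      by apply: or2; exact: arm_same km mi kp mp.
    by apply: or1; exact: arm_same mk ki mp kp.
  + by right; apply: or2; subst B; exact: arm_next ki mi kp mp.
  + by right; apply: or1; subst A; exact: arm_next mi ki mp kp.
Qed.

(** The graph lists spokes outwards and the other edges along an arm inwards, hence the test on
    [k]. *)
Definition edge_of (b : bool) A k : vertex * vertex :=
  if b then if k == 0%N then (arm_vertex A k, arm_vertex A k.+1)
            else (arm_vertex A k.+1, arm_vertex A k)
  else (arm_vertex (next_arm A) k, arm_vertex A k.+1).

Lemma arm_edgeP e : arm_edge i e ->
  exists b A k, edge_ok b k /\ e = edge_of b A k.
Proof.
case=> [A|A [//|k] ki|A k /andP[k0 ki]].
- by exists true, A, 0%N.
- by exists true, A, k.+1; rewrite /edge_ok andbT.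
- by exists false, A, k; rewrite /edge_ok ki.
Qed.

Lemma edge_of_pos b A k : edge_ok b k -> let e := edge_of b A k in
  Gamma' R i e.1 = edge_fst b A k /\ Gamma' R i e.2 = edge_snd b A k \/
  Gamma' R i e.1 = edge_snd b A k /\ Gamma' R i e.2 = edge_fst b A k.
Proof.
move=> /andP[ki k0]; have ki1 := leqW ki.
rewrite /edge_of /edge_fst /edge_snd.
case: b k0 => k0; last by right; rewrite !Gamma'_arm_vertex.
by case: eqP => _ /=; [left|right]; rewrite !Gamma'_arm_vertex.
Qed.

Lemma segment_edge_of b A k : edge_ok b k ->
  segment (Gamma' R i (edge_of b A k).1) (Gamma' R i (edge_of b A k).2) =
  segment (edge_fst b A k) (edge_snd b A k).
Proof.
by move=> /(edge_of_pos A) /= [[-> ->]//|[-> ->]]; rewrite segment_sym.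
Qed.

Lemma edge_of_endpoint b A k p : edge_ok b k ->
  p = edge_fst b A k \/ p = edge_snd b A k ->
  exists2 w, w \in [:: (edge_of b A k).1; (edge_of b A k).2] & p = Gamma' R i w.
Proof.
move=> /(edge_of_pos A) /= [[e1 e2]|[e1 e2]] [->|->];
  by [exists (edge_of b A k).1; rewrite ?inE ?eqxx
     |exists (edge_of b A k).2; rewrite ?inE ?eqxx ?orbT].
Qed.

Lemma edge_of_vertices b A k w : edge_ok b k ->
  w \in [:: (edge_of b A k).1; (edge_of b A k).2] ->
  w \in vertices (graphH i).
Proof.
move=> /andP[ki _]; have ki1 := leqW ki; rewrite /edge_of.
by case: b; [case: eqP => _|]; rewrite !inE => /orP[] /eqP->; apply/mem_vertices => //;
  [exists A, k|exists A, k.+1|exists A, k.+1|exists A, k|exists (next_arm A), k|exists A, k.+1].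
Qed.

Lemma Gamma'_planar : planar_drawing (graphH i) (Gamma' R i).
Proof.
have inj : {in vertices (graphH i) &, injective (Gamma' R i)}.
  move=> u v /(mem_vertices _ i_gt0)[A [k [ki ->]]] /(mem_vertices _ i_gt0)[B [m [mi ->]]].
  by rewrite !Gamma'_arm_vertex//; exact: arm_pos_inj.
have vertex_edge : {in vertices (graphH i) & edges (graphH i), forall w e,
    segment (Gamma' R i e.1) (Gamma' R i e.2) (Gamma' R i w) -> w \in [:: e.1; e.2]}.
  move=> w e wG /(mem_edges _ i_gt0)/arm_edgeP[b [A [k [bk ->]]]].
  rewrite segment_edge_of// => wk.
  have [C [m [mi wE]]] := (mem_vertices _ i_gt0).1 wG.
  move: wk; rewrite {1}wE Gamma'_arm_vertex// => wk.
  have [v vk] := edge_of_endpoint bk (edge_vertex bk mi wk).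
  rewrite -Gamma'_arm_vertex// -wE => /inj -> //.
  exact: edge_of_vertices vk.
split=> //.
move=> e f eG fG ef p ep fp.
suff [w wG pE] : exists2 w, w \in vertices (graphH i) & p = Gamma' R i w.
  by exists w; split=> //; apply: vertex_edge; rewrite -?pE.
move: eG fG ef ep fp.
move=> /(mem_edges _ i_gt0)/arm_edgeP[b [A [k [bk ->]]]].
move=> /(mem_edges _ i_gt0)/arm_edgeP[c [B [m [cm ->]]]] ef.
rewrite !segment_edge_of// => ep fp.
have [[bc AB km]|pE] := edge_cross bk cm ep fp; first by case: ef; rewrite bc AB km.
have [pb|pc] : (p = edge_fst b A k \/ p = edge_snd b A k) \/
    (p = edge_fst c B m \/ p = edge_snd c B m).
- by case: pE => pE; [left; left|left; right|right; left|right; right].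
- have [w wk ->] := edge_of_endpoint bk pb.
  by exists w => //; exact: edge_of_vertices wk.
- have [w wk ->] := edge_of_endpoint cm pc.
  by exists w => //; exact: edge_of_vertices wk.
Qed.

End Planarity.


(** * Angle-monotone paths *)

Section MonotonePaths.
Variables (R : realType) (i : nat).
Hypothesis i_gt0 : (0 < i)%N.
Implicit Types (A : arm) (k m : nat) (u v : vertex) (D : rel (R * R)).

Local Notation pos := (Gamma' R i).
Local Notation G := (graphH i).

Let i1 : 1 <= i%:R :> R. Proof. by rewrite ler1n. Qed.

Lemma segment_wedge_opp (beta : R) (p q : R * R) :
  segment p q `<=` wedge beta p -> segment q p `<=` wedge (beta + pi) q.
Proof.
move=> pq; have [rho [theta [rho0 /andP[th1 th2] qE]]] := pq _ (segment_r p q).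
move=> a /segmentP[t [t0 t1 ->]]; exists (t * rho), (theta + pi); split.
- exact: mulr_ge0.
- by apply/andP; split; lra.
- rewrite cosDpi sinDpi [RHS]surjective_pairing /= {1 2}qE /=.
  by congr (_, _); rewrite qE /= /GRing.scale /=; ring.
Qed.

(** Walks, which concatenate freely; loops are removed only in [reach_monotone], where the remaining
    steps still satisfy [D]. *)
Definition reach D u v : Prop :=
  exists2 w, path (fun x y => adj G x y && D (pos x) (pos y)) u w & last u w = v.

Lemma reach_refl D u : reach D u u.
Proof. by exists [::]. Qed.

Lemma reach_trans D u v w : reach D u v -> reach D v w -> reach D u w.
Proof.
move=> [s us <-] [t vt <-]; exists (s ++ t); last by rewrite last_cat.
by rewrite cat_path us.
Qed.

Lemma reach_step D u v : adj G u v -> D (pos u) (pos v) -> reach D u v.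
Proof. by move=> uv Duv; exists [:: v] => //=; rewrite uv Duv. Qed.

Definition monotone_linked u v : Prop := exists (beta : R) (w : seq vertex),
  [/\ path (adj G) u w, uniq (u :: w), last u w = v &
      monotone_path beta (map pos (u :: w))].

Lemma monotone_pathP (beta : R) u w :
  path (fun x y => `[< segment (pos x) (pos y) `<=` wedge beta (pos x) >]) u w <->
  monotone_path beta (map pos (u :: w)).
Proof.
rewrite /monotone_path; elim: w u => [|v w IH] u; first by split.
split=> [/= /andP[/asboolP uv /IH vw] s|H].
  by rewrite inE => /predU1P[->//|]; exact: vw.
rewrite /= (asboolT (H (pos u, pos v) _)) ?inE ?eqxx//=; apply/IH => s sw.
by apply: H; rewrite /= inE sw orbT.
Qed.

Lemma reach_monotone D u v :
  (exists beta : R, forall p q, D p q -> segment p q `<=` wedge beta p) ->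
  reach D u v -> monotone_linked u v.
Proof.
move=> [beta Dbeta] [w uw <-].
have [w' uw' uniq_w' _] := shortenP uw.
exists beta, w'; split=> //; first by apply: sub_path uw' => x y /andP[].
apply/monotone_pathP; apply: sub_path uw' => x y /andP[_ Dxy].
by apply/asboolP/Dbeta.
Qed.

Lemma adj_sym u v : adj G u v = adj G v u.
Proof. by rewrite /adj orbC. Qed.

Lemma monotone_linked_sym u v : monotone_linked u v -> monotone_linked v u.
Proof.
move=> [beta [w [uw uniq_w <- /monotone_pathP bw]]].
exists (beta + pi), (rev (belast u w)); split.
- by rewrite rev_path; apply: sub_path uw => x y; rewrite adj_sym.
- by rewrite -rev_rcons -lastI rev_uniq.
- by case: (w) => // x s; rewrite /= rev_cons last_rcons.
- apply/monotone_pathP; rewrite rev_path; apply: sub_path bw => x y /asboolP xy.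
  by apply/asboolP; exact: segment_wedge_opp.
Qed.

Lemma adj_along A k : (k <= i)%N -> adj G (arm_vertex A k.+1) (arm_vertex A k).
Proof.
case: k => [|k] ki; apply/orP; [right|left]; apply/mem_edges => //.
  exact: Spoke.
exact: Along.
Qed.

Lemma adj_across A k : (0 < k <= i)%N ->
  adj G (arm_vertex A k.+1) (arm_vertex (next_arm A) k).
Proof. by move=> ki; apply/orP; right; apply/mem_edges => //; exact: Across. Qed.

Lemma reach_down D A k m : (k <= m <= i.+1)%N ->
  (forall j, (k <= j < m)%N -> D (arm_pos R i A j.+1) (arm_pos R i A j)) ->
  reach D (arm_vertex A m) (arm_vertex A k).
Proof.
elim: m => [|m IH] /andP[km mi] H.
  by move: km; rewrite leqn0 => /eqP->; exact: reach_refl.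
move: km; rewrite leq_eqVlt => /predU1P[->|km]; first exact: reach_refl.
apply: (@reach_trans _ _ (arm_vertex A m)).
  apply: reach_step; first by apply: adj_along.
  rewrite (Gamma'_arm_vertex R i_gt0 A mi) (Gamma'_arm_vertex R i_gt0 A (ltnW mi)).
  by apply: H; rewrite -ltnS km ltnSn.
apply: IH; first by rewrite -ltnS km ltnW.
by move=> j /andP[kj jm]; apply: H; rewrite kj leqW.
Qed.

Lemma reach_up D A k m : (k <= m <= i.+1)%N ->
  (forall j, (k <= j < m)%N -> D (arm_pos R i A j) (arm_pos R i A j.+1)) ->
  reach D (arm_vertex A k) (arm_vertex A m).
Proof.
elim: m => [|m IH] /andP[km mi] H.
  by move: km; rewrite leqn0 => /eqP->; exact: reach_refl.
move: km; rewrite leq_eqVlt => /predU1P[->|km]; first exact: reach_refl.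
apply: (@reach_trans _ _ (arm_vertex A m)).
  apply: IH; first by rewrite -ltnS km ltnW.
  by move=> j /andP[kj jm]; apply: H; rewrite kj leqW.
apply: reach_step; first by rewrite adj_sym; apply: adj_along.
rewrite (Gamma'_arm_vertex R i_gt0 A mi) (Gamma'_arm_vertex R i_gt0 A (ltnW mi)).
  by apply: H; rewrite -ltnS km ltnSn.
Qed.

(** The next four relations are the cones of aperture pi / 2 bisected by the slopes -pi / 2, pi, pi
    / 4 and -pi / 4. *)
Definition goes_down (p q : R * R) : bool := `|q.1 - p.1| <= p.2 - q.2.
Definition goes_left (p q : R * R) : bool := `|q.2 - p.2| <= p.1 - q.1.
Definition goes_right_up (p q : R * R) : bool := (p.1 <= q.1) && (p.2 <= q.2).
Definition goes_right_down (p q : R * R) : bool := (p.1 <= q.1) && (q.2 <= p.2).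

Lemma goes_downP (p q : R * R) : goes_down p q <->
  q.1 - p.1 <= p.2 - q.2 /\ p.1 - q.1 <= p.2 - q.2.
Proof.
rewrite /goes_down ler_norml; split=> [/andP[]|[]] *; last (apply/andP; split); lra.
Qed.

Lemma goes_leftP (p q : R * R) : goes_left p q <->
  q.2 - p.2 <= p.1 - q.1 /\ p.2 - q.2 <= p.1 - q.1.
Proof.
rewrite /goes_left ler_norml; split=> [/andP[]|[]] *; last (apply/andP; split); lra.
Qed.

(** The inequalities hold for ordinary steps and for the displaced last one alike. The last step of
    the left arm is vertical, so [x = y] is claimed only for [j < i]; this keeps l_(i+1) out of
    [left_left]. *)
Lemma arm_step A j : (j <= i)%N ->
  exists x y : R,
    [/\ arm_pos R i A j.+1 = ((arm_pos R i A j).1 + x, (arm_pos R i A j).2 + y),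
        A = Top -> 0 <= y /\ - y <= x <= 0,
        A = Left -> y <= x <= 0 /\ ((j < i)%N -> x = y),
        A = Right -> 0 <= x /\ - x <= y <= 0 & True].
Proof.
move=> ji.
have [ji'|ij] := ltnP j i; last first.
  have -> : j = i by apply/eqP; rewrite eqn_leq ji.
  rewrite /arm_pos leqnn ltnn.
  case: A => /=; rewrite ?eqxx /=.
  - exists (-1), 1; split=> //; first by congr (_, _); ring.
    by move=> _; split=> //; apply/andP; split; lra.
  - exists 0, (-1); split=> //; first by congr (_, _); ring.
    by move=> _; split=> //; apply/andP; split; lra.
  - exists 1, 0; split=> //; first by congr (_, _); ring.
    by move=> _; split=> //; apply/andP; split; lra.
have l0 : 0 <= arm_len R i A j.+1 - arm_len R i A j.
  by rewrite subr_ge0; apply/ltW/arm_len_lt; rewrite ltnSn.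
move: l0; set l := _ - _ => l0.
exists (l * (arm_dir R A).1), (l * (arm_dir R A).2).
have lE : arm_len R i A j.+1 = arm_len R i A j + l by rewrite /l subrKC.
rewrite !arm_posE//= lE; split=> //.
- by congr (_, _); ring.
- by move=> ->; rewrite /=; split; [lra|apply/andP; split; lra].
- by move=> ->; rewrite /=; split; [apply/andP; split; lra|lra].
- by move=> ->; rewrite /=; split; [lra|apply/andP; split; lra].
Qed.

Lemma top_down k m : (k <= m <= i.+1)%N ->
  reach goes_down (arm_vertex Top m) (arm_vertex Top k).
Proof.
move=> /[dup] /andP[_ mi] km; apply: reach_down => // j /andP[_ jm].
have [x [y [-> + _ _ _]]] := arm_step Top (leq_trans jm mi : (j <= i)%N).
by move=> /(_ erefl)[y0 /andP[x1 x2]]; apply/goes_downP => /=; split; lra.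
Qed.

Lemma left_down k m : (k <= m <= i.+1)%N ->
  reach goes_down (arm_vertex Left k) (arm_vertex Left m).
Proof.
move=> /[dup] /andP[_ mi] km; apply: reach_up => // j /andP[_ jm].
have [x [y [-> _ + _ _]]] := arm_step Left (leq_trans jm mi : (j <= i)%N).
by move=> /(_ erefl)[/andP[x1 x2] _]; apply/goes_downP => /=; split; lra.
Qed.

Lemma top_right_down k m : (k <= m <= i.+1)%N ->
  reach goes_right_down (arm_vertex Top m) (arm_vertex Top k).
Proof.
move=> /[dup] /andP[_ mi] km; apply: reach_down => // j /andP[_ jm].
have [x [y [-> + _ _ _]]] := arm_step Top (leq_trans jm mi : (j <= i)%N).
by move=> /(_ erefl)[y0 /andP[x1 x2]]; apply/andP => /=; split; lra.
Qed.

Lemma right_right_down k m : (k <= m <= i.+1)%N ->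
  reach goes_right_down (arm_vertex Right k) (arm_vertex Right m).
Proof.
move=> /[dup] /andP[_ mi] km; apply: reach_up => // j /andP[_ jm].
have [x [y [-> _ _ + _]]] := arm_step Right (leq_trans jm mi : (j <= i)%N).
by move=> /(_ erefl)[x0 /andP[y1 y2]]; apply/andP => /=; split; lra.
Qed.

Lemma right_left k m : (k <= m <= i.+1)%N ->
  reach goes_left (arm_vertex Right m) (arm_vertex Right k).
Proof.
move=> /[dup] /andP[_ mi] km; apply: reach_down => // j /andP[_ jm].
have [x [y [-> _ _ + _]]] := arm_step Right (leq_trans jm mi : (j <= i)%N).
by move=> /(_ erefl)[x0 /andP[y1 y2]]; apply/goes_leftP => /=; split; lra.
Qed.

Lemma left_left k m : (k <= m <= i)%N ->
  reach goes_left (arm_vertex Left k) (arm_vertex Left m).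
Proof.
move=> /andP[km mi]; apply: reach_up; first by rewrite km leqW.
move=> j /andP[_ jm]; have ji := leq_trans jm mi.
have [x [y [-> _ + _ _]]] := arm_step Left (ltnW ji).
by move=> /(_ erefl)[/andP[x1 x2] /(_ ji) xy]; apply/goes_leftP => /=; split; lra.
Qed.

Lemma left_right_up k m : (k <= m <= i.+1)%N ->
  reach goes_right_up (arm_vertex Left m) (arm_vertex Left k).
Proof.
move=> /[dup] /andP[_ mi] km; apply: reach_down => // j /andP[_ jm].
have [x [y [-> _ + _ _]]] := arm_step Left (leq_trans jm mi : (j <= i)%N).
by move=> /(_ erefl)[/andP[x1 x2] _]; apply/andP => /=; split; lra.
Qed.

(** The edge rises by one for [k < i] and is horizontal for [k = i]. *)
Lemma across_right_up k : (0 < k <= i)%N ->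
  reach goes_right_up (arm_vertex Left k.+1) (arm_vertex Right k).
Proof.
move=> ki; apply: reach_step; first exact: (adj_across Left).
have /andP[k0 ki'] := ki.
rewrite (Gamma'_arm_vertex R i_gt0 _ (ki' : (k.+1 <= i.+1)%N)).
rewrite (Gamma'_arm_vertex R i_gt0 _ (leqW ki')).
have := i1; have k1 : 1 <= k%:R :> R by rewrite ler1n.
move: ki'; rewrite leq_eqVlt => /predU1P[->|ki'] n1.
  by rewrite /arm_pos ltnn leqnn /= eqxx; apply/andP => /=; split; lra.
rewrite (arm_posE R Left ki') (arm_posE R Right (ltnW ki')) /arm_len.
rewrite (ltn_eqF ki') /= -natr1.
by apply/andP => /=; split; lra.
Qed.

(* The vertex [l_(i+1)] is the only one that does not reach the right arm
   monotonically through the centre: the path goes down the left arm, then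
   crosses directly to its target. *)
Lemma left_to_right k : (k <= i.+1)%N ->
  reach goes_right_up (arm_vertex Left i.+1) (arm_vertex Right k).
Proof.
case: k => [|k] ki; first by apply: (left_right_up (k := 0%N)); rewrite leqnn.
move: ki; rewrite leq_eqVlt => /predU1P[[->]|ki].
  apply: reach_trans (across_right_up (k := i) _) _; first by rewrite i_gt0 leqnn.
  apply: reach_step; first by rewrite adj_sym; apply: adj_along.
  by rewrite !Gamma'_arm_vertex// /arm_pos ltnn leqnn /= eqxx; apply/andP => /=; split; lra.
apply: (@reach_trans _ _ (arm_vertex Left k.+2)).
  by apply: left_right_up; rewrite leqnn andbT.
exact: across_right_up.
Qed.

Lemma Gamma'_angle_monotone : angle_monotone G pos.
Proof.
move=> u v /(mem_vertices _ i_gt0)[A [k [ki ->]]] /(mem_vertices _ i_gt0)[B [m [mi ->]]].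
rewrite -/(monotone_linked _ _).
have same C j l : (j <= l <= i.+1)%N ->
    monotone_linked (arm_vertex C j) (arm_vertex C l).
  move=> jl; case: C.
  - apply: monotone_linked_sym; apply: (@reach_monotone goes_down) (top_down jl).
    exact: wedge_down.
  - apply: (@reach_monotone goes_down) (left_down jl).
    exact: wedge_down.
  - apply: monotone_linked_sym; apply: (@reach_monotone goes_left) (right_left jl).
    exact: wedge_left.
have top_left j l : (j <= i.+1)%N -> (l <= i.+1)%N ->
    monotone_linked (arm_vertex Top j) (arm_vertex Left l).
  move=> ji li; apply: (@reach_monotone goes_down); first exact: wedge_down.
  by apply: (@reach_trans _ _ (Vx 0)); [exact: (@top_down 0)|exact: (@left_down 0)].
have top_right j l : (j <= i.+1)%N -> (l <= i.+1)%N ->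
    monotone_linked (arm_vertex Top j) (arm_vertex Right l).
  move=> ji li; apply: (@reach_monotone goes_right_down).
    have [beta H] := @wedge_right_down R.
    by exists beta => p q /andP[]; exact: H.
  by apply: (@reach_trans _ _ (Vx 0)); [exact: (@top_right_down 0)|exact: (@right_right_down 0)].
have right_left j l : (j <= i.+1)%N -> (l <= i.+1)%N ->
    monotone_linked (arm_vertex Right j) (arm_vertex Left l).
  move=> ji; rewrite leq_eqVlt => /predU1P[->|li].
    apply: monotone_linked_sym; apply: (@reach_monotone goes_right_up).
      have [beta H] := @wedge_right_up R.
      by exists beta => p q /andP[]; exact: H.
    exact: left_to_right.
  apply: (@reach_monotone goes_left); first exact: wedge_left.
  by apply: (@reach_trans _ _ (Vx 0)); [exact: (@right_left 0)|exact: (@left_left 0)].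
case: A; case: B.
- have [km|/ltnW mk] := leqP k m; first by apply: same; rewrite km.
  by apply/monotone_linked_sym/same; rewrite mk.
- exact: top_left.
- exact: top_right.
- by apply/monotone_linked_sym/top_left.
- have [km|/ltnW mk] := leqP k m; first by apply: same; rewrite km.
  by apply/monotone_linked_sym/same; rewrite mk.
- by apply/monotone_linked_sym/right_left.
- by apply/monotone_linked_sym/top_right.
- exact: right_left.
- have [km|/ltnW mk] := leqP k m; first by apply: same; rewrite km.
  by apply/monotone_linked_sym/same; rewrite mk.
Qed.

End MonotonePaths.


(** * Embedding and grid *)

Section PolygonSymmetry.
Context {R : realType}.
Implicit Types (P : seq (R * R)).

Lemma zip_rot (S T : Type) n (s : seq S) (t : seq T) : size s = size t ->
  zip (rot n s) (rot n t) = rot n (zip s t).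
Proof.
move=> st; rewrite /rot zip_cat ?size_drop ?st//; congr (_ ++ _).
  by elim: n s t {st} => [|n IH] [|x s] [|y t] //=; rewrite ?IH//; case: drop.
by elim: n s t {st} => [|n IH] [|x s] [|y t] //=; rewrite ?IH//; case: take.
Qed.

Lemma polygon_rot n P : polygon (rot n P) = polygon P.
Proof.
suff E u : (u \in zip (rot n P) (rot 1 (rot n P))) = (u \in zip P (rot 1 P)).
  by apply/seteqP; split=> a [u uP ua]; exists u; rewrite ?E// -E.
by rewrite rot_rot zip_rot ?size_rot// mem_rot.
Qed.

Lemma mem_zipC (S T : eqType) (s : seq S) (t : seq T) x y :
  ((x, y) \in zip s t) = ((y, x) \in zip t s).
Proof.
elim: s t => [|a s IH] [|b t] //=.
by rewrite !inE IH; congr orb; rewrite !xpair_eqE andbC.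
Qed.

(** Reversing the list swaps the ends of each side but shifts the cyclic alignment by one, which
    [rotr 1] absorbs. *)
Lemma polygon_rev P : polygon (rev P) = polygon P.
Proof.
have -> : polygon P = polygon (rotr 1 P) by rewrite -[in LHS](rotrK 1 P) polygon_rot.
have E x y : ((x, y) \in zip (rev P) (rot 1 (rev P))) =
    ((y, x) \in zip (rotr 1 P) (rot 1 (rotr 1 P))).
  by rewrite rotrK mem_zipC -rev_rotr -rev_zip ?size_rotr// mem_rev.
by apply/seteqP; split=> a [[x y] xyP xya]; exists (y, x); rewrite ?E// -?E//=
  segment_sym.
Qed.

End PolygonSymmetry.

Lemma segment_fst (R : realType) (p q : R * R) (x : R) :
  p.1 < q.1 -> p.1 <= x <= q.1 -> exists2 a, segment p q a & a.1 = x.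
Proof.
move=> pq /andP[px xq]; pose t := (x - p.1) / (q.1 - p.1).
have d0 : 0 < q.1 - p.1 by rewrite subr_gt0.
exists (p.1 + t * (q.1 - p.1), p.2 + t * (q.2 - p.2)).
  apply/segmentP; exists t; split=> //.
    by rewrite divr_ge0// ?subr_ge0// ltW.
  by rewrite ler_pdivrMr// mul1r lerB.
by rewrite /= divfK ?gt_eqF// subrKC.
Qed.

Lemma segment_snd (R : realType) (p q : R * R) (y : R) :
  p.2 < q.2 -> p.2 <= y <= q.2 -> exists2 a, segment p q a & a.2 = y.
Proof.
move=> pq /andP[py yq]; pose t := (y - p.2) / (q.2 - p.2).
have d0 : 0 < q.2 - p.2 by rewrite subr_gt0.
exists (p.1 + t * (q.1 - p.1), p.2 + t * (q.2 - p.2)).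
  apply/segmentP; exists t; split=> //.
    by rewrite divr_ge0// ?subr_ge0// ltW.
  by rewrite ler_pdivrMr// mul1r lerB.
by rewrite /= divfK ?gt_eqF// subrKC.
Qed.

Section Conclusion.
Variables (R : realType) (i : nat).
Hypothesis i_gt0 : (0 < i)%N.
Implicit Types (A : arm) (k m : nat).

Local Notation pos := (Gamma' R i).
Local Notation G := (graphH i).

Let i1 : 1 <= i%:R :> R. Proof. by rewrite ler1n. Qed.

Lemma map_cell_cycle A k : (0 < k <= i)%N -> map pos (cell_cycle A k) = cell R i A k.
Proof.
move=> /andP[k0 ki]; rewrite /cell_cycle /=.
rewrite (Gamma'_arm_vertex R i_gt0 _ (leqW ki)).
rewrite (Gamma'_arm_vertex R i_gt0 _ (ki : (k.+1 <= i.+1)%N)).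
rewrite (Gamma'_arm_vertex R i_gt0 _ (leqW ki)).
by rewrite (Gamma'_arm_vertex R i_gt0 _ (leqW (leq_trans (leq_pred k) ki))).
Qed.

Lemma map_hexagon_cycle : map pos (hexagon_cycle i) = hexagon R i.
Proof. by rewrite /hexagon_cycle /= !Gamma'_arm_vertex. Qed.

Lemma arm_vertex_neq_level A B k m : k != m -> arm_vertex A k != arm_vertex B m.
Proof. by apply: contraNneq => /arm_vertex_inj[->]. Qed.

Lemma arm_vertex_neq_arm A B k : A <> B -> (0 < k)%N -> arm_vertex A k != arm_vertex B k.
Proof.
by move=> AB k0; apply/eqP => /arm_vertex_inj[_ [//|k00]]; rewrite k00 in k0.
Qed.

Lemma cell_ucycle A k : (0 < k <= i)%N -> ucycle (adj G) (cell_cycle A k).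
Proof.
move=> ki; have /andP[k0 ki'] := ki; have k1i := leq_trans (leq_pred k) ki'.
apply/andP; split.
  rewrite /cell_cycle /= adj_sym adj_along// adj_across//=.
  rewrite -{1}(prednK k0) adj_along//= andbT.
  case: k k0 ki ki' k1i => [//|[_ _ _ _|k _ ki ki' _]] /=.
    by rewrite adj_sym (@adj_along i i_gt0 A 0).
  by rewrite adj_sym adj_across//= ltnW.
have AB : A <> next_arm A by case: (A).
have n1 : k != k.+1 by rewrite ltn_eqF.
have n2 : k.+1 != k by rewrite eq_sym.
have n3 : k != k.-1 by rewrite gtn_eqF// prednK.
have n4 : k.+1 != k.-1 by rewrite gtn_eqF// ltnS leq_pred.
rewrite /cell_cycle /= !inE !negb_or.
by do ?[apply/andP; split] => //; first
  [exact: arm_vertex_neq_arm|exact: arm_vertex_neq_level].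
Qed.

Lemma hexagon_ucycle : ucycle (adj G) (hexagon_cycle i).
Proof.
apply/andP; split.
  rewrite /hexagon_cycle /= [adj G (arm_vertex Left i) _]adj_sym.
  rewrite [adj G (arm_vertex Right i) _]adj_sym [adj G (arm_vertex Top i) _]adj_sym.
  rewrite !adj_along// (@adj_across i i_gt0 Top) ?i_gt0 ?leqnn//.
  rewrite (@adj_across i i_gt0 Left) ?i_gt0 ?leqnn//.
  by rewrite (@adj_across i i_gt0 Right) ?i_gt0 ?leqnn.
have n1 : i != i.+1 by rewrite ltn_eqF.
have n2 : i.+1 != i by rewrite eq_sym.
rewrite /hexagon_cycle /= !inE !negb_or.
by do ?[apply/andP; split] => //; first
  [exact: arm_vertex_neq_level|exact: arm_vertex_neq_arm].
Qed.

Lemma Gamma'_convex : convex_drawing G pos.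
Proof.
split; first exact: Gamma'_planar.
move=> F /(faceP i_gt0)[[A [k [ki ->]]]|->].
  have bd := cell_bounds_region R i_gt0 A ki.
  exists (cell_cycle A k); rewrite map_cell_cycle//; split=> //.
  - exact: cell_ucycle.
  - exact: frontier_open_region.
  - exact: convex_polygon_bounds.
have bd := hexagon_bounds_region R i_gt0.
exists (hexagon_cycle i); rewrite map_hexagon_cycle; split=> //.
- exact: hexagon_ucycle.
- exact: frontier_regionC.
- exact: convex_polygon_bounds.
Qed.

Lemma polygon_outer_face :
  polygon (map pos (outer_face G)) = polygon (hexagon R i).
Proof.
rewrite outer_face_graphH//; have [n ->] := outer_cycle_rot i_gt0.
by rewrite map_rot map_rev map_hexagon_cycle polygon_rot polygon_rev.
Qed.

Lemma inner_face_polygon c A k : (0 < k <= i)%N ->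
  c = (if k == 1%N then rev (cell_cycle A k) else rot 1 (rev (cell_cycle A k))) ->
  polygon (map pos c) = polygon (cell R i A k).
Proof.
move=> ki ->; case: ifP => _; rewrite ?map_rot map_rev map_cell_cycle//.
  by rewrite polygon_rev.
by rewrite polygon_rot polygon_rev.
Qed.

Lemma Gamma'_respects_embedding : respects_embedding G pos.
Proof.
have frC A k : (0 < k <= i)%N ->
    frontier (open_region (cell R i A k)) = polygon (cell R i A k).
  by move=> ki; apply/frontier_open_region/cell_bounds_region.
have frO : frontier (~` region (hexagon R i)) = polygon (hexagon R i).
  exact/frontier_regionC/hexagon_bounds_region.
split; first exact: Gamma'_planar.
- move=> c /(mem_inner_faces _ i_gt0)[A [k [ki cE]]].
  exists (open_region (cell R i A k)); split.
  + by apply/faceP => //; left; exists A, k.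
  + exact: bounded_open_cell.
  + by rewrite (inner_face_polygon ki cE) frC.
- exists (~` region (hexagon R i)); split.
  + by apply/faceP => //; right.
  + exact: unbounded_outer.
  + by rewrite polygon_outer_face.
- move=> F /(faceP i_gt0)[[A [k [ki ->]]]|->]; split.
  + move=> _; pose c := (if k == 1%N then rev (cell_cycle A k)
                         else rot 1 (rev (cell_cycle A k))).
    exists c; first by apply/mem_inner_faces => //; exists A, k.
    by rewrite (@inner_face_polygon c A k ki erefl) frC.
  + by case; exact: bounded_open_cell.
  + by move/(unbounded_outer i_gt0).
  + by rewrite polygon_outer_face.
Qed.

Lemma drawing_sub_hexagon p : drawing G pos p -> region (hexagon R i) p.
Proof.
move=> /(drawing_cells i_gt0)[A [k [ki kp]]].
apply: (cell_sub_hexagon i_gt0 ki).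
exact: polygon_sub_region (cell_bounds_region R i_gt0 A ki) _ kp.
Qed.

Lemma arm_along_drawing A p :
  segment (arm_pos R i A i) (arm_pos R i A i.+1) p -> drawing G pos p.
Proof. by move=> ip; apply/Gamma'_drawingP => //; exists A, i; left. Qed.

Lemma arm_across_drawing A p :
  segment (arm_pos R i A i.+1) (arm_pos R i (next_arm A) i) p -> drawing G pos p.
Proof.
by move=> ip; apply/Gamma'_drawingP => //; exists A, i; right; rewrite i_gt0 leqnn.
Qed.

Lemma card_int_interval (X : set int) (a : int) (n : nat) :
  (forall k : int, X k <-> a <= k /\ k < a + n%:Z) -> X #= `I_n.
Proof.
move=> XE; have -> : X = (fun j : nat => a + j%:Z) @` `I_n.
  apply/seteqP; split=> [k /XE[ak kn]|k [j /= jn <-]].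
    by exists `|k - a|%N => /=; lia.
  by apply/XE; lia.
by apply: inj_card_eq => j l _ _ /= /addrI[].
Qed.

(** The bottom line of the hexagon, from l_(i+1) through r_i to r_(i+1), meets every column from -i
    to i + 2. *)
Lemma Gamma'_columns (k : int) :
  columns G pos k <-> - i%:Z <= k /\ k < - i%:Z + (2 * i + 3)%:Z.
Proof.
have n1 := i1; set n := i%:R in n1.
have iR : i%:Z%:~R = n :> R by [].
split=> [[p /drawing_sub_hexagon /region_hexagon H pk]|[k1 k2]].
  have [] := H Left; have [] := H Right.
  rewrite !hexagon_along// !hexagon_across// -/n => h1 h2 h3 h4.
  have l1 : (- i%:Z)%:~R <= k%:~R :> R by rewrite -pk intrN iR; lra.
  have l2 : k%:~R <= (i%:Z + 2)%:~R :> R by rewrite -pk intrD iR; nra.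
  by move: l1 l2; rewrite !ler_int; lia.
have kn : - n <= k%:~R by rewrite -iR -intrN ler_int.
have kn2 : k%:~R <= n + 2 by rewrite -iR -(intrD _ _ 2) ler_int; lia.
have [kn1|/ltW kn1] := leP (k%:~R : R) (n + 1).
  have [] := @segment_fst R (arm_pos R i Left i.+1) (arm_pos R i Right i) k%:~R.
  - by rewrite /arm_pos ltnn leqnn /= eqxx /= -/n; lra.
  - by rewrite /arm_pos ltnn leqnn /= eqxx /= -/n; apply/andP; split; lra.
  by move=> p /(arm_across_drawing (A := Left)) pD pk; exists p.
have [] := @segment_fst R (arm_pos R i Right i) (arm_pos R i Right i.+1) k%:~R.
- by rewrite /arm_pos ltnn leqnn /= eqxx /= -/n; lra.
- by rewrite /arm_pos ltnn leqnn /= eqxx /= -/n; apply/andP; split; lra.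
by move=> p /arm_along_drawing pD pk; exists p.
Qed.

(** The left boundary, from l_(i+1) through l_i to t_(i+1), meets every row from -i - 1 to i + 1. *)
Lemma Gamma'_rows (k : int) :
  rows G pos k <-> - i%:Z - 1 <= k /\ k < - i%:Z - 1 + (2 * i + 3)%:Z.
Proof.
have n1 := i1; set n := i%:R in n1.
have iR : i%:Z%:~R = n :> R by [].
split=> [[p /drawing_sub_hexagon /region_hexagon H pk]|[k1 k2]].
  have [] := H Left; have [] := H Right; have [] := H Top.
  rewrite !hexagon_along// !hexagon_across// -/n => h1 h2 h3 h4 h5 h6.
  have l1 : (- i%:Z - 1)%:~R <= k%:~R :> R by rewrite -pk intrB intrN iR; lra.
  have l2 : k%:~R <= (i%:Z + 1)%:~R :> R.
    by rewrite -pk intrD iR leNgt; apply/negP => yn; nra.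
  by move: l1 l2; rewrite !ler_int; lia.
have kn : - n - 1 <= k%:~R by rewrite -iR -intrN -(intrB _ _ 1) ler_int.
have kn2 : k%:~R <= n + 1 by rewrite -iR -(intrD _ _ 1) ler_int; lia.
have [kn1|/ltW kn1] := leP (k%:~R : R) (- n).
  have [] := @segment_snd R (arm_pos R i Left i.+1) (arm_pos R i Left i) k%:~R.
  - by rewrite /arm_pos ltnn leqnn /= -/n; lra.
  - by rewrite /arm_pos ltnn leqnn /= -/n; apply/andP; split; lra.
  by move=> p; rewrite segment_sym => /arm_along_drawing pD pk; exists p.
have [] := @segment_snd R (arm_pos R i Left i) (arm_pos R i Top i.+1) k%:~R.
- by rewrite /arm_pos ltnn leqnn /= -/n; lra.
- by rewrite /arm_pos ltnn leqnn /= -/n; apply/andP; split; lra.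
move=> p; rewrite segment_sym => /(arm_across_drawing (A := Top)) pD pk.
by exists p.
Qed.

Lemma arm_pos_int A k :
  ((arm_pos R i A k).1 \is a Num.int) && ((arm_pos R i A k).2 \is a Num.int).
Proof.
rewrite /arm_pos /arm_len; case: ifP => _; case: A => /=;
  by rewrite ?(rpredM, rpredD, rpredB, rpredN, rpred0, rpred1, rpred_nat).
Qed.

Lemma Gamma'_on_grid : on_grid G pos (2 * i + 3) (2 * i + 3).
Proof.
split.
- move=> v /(mem_vertices _ i_gt0)[A [k [ki ->]]].
  by rewrite Gamma'_arm_vertex//; exact: arm_pos_int.
- by apply: card_int_interval => k; exact: Gamma'_columns.
- by apply: card_int_interval => k; exact: Gamma'_rows.
Qed.

End Conclusion.

Theorem claim2 (R : realType) (i : nat) (hi : (1 <= i)%N) :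
  [/\ respects_embedding (graphH i) (Gamma' R i),
      convex_drawing (graphH i) (Gamma' R i),
      angle_monotone (graphH i) (Gamma' R i) &
      on_grid (graphH i) (Gamma' R i) (2 * i + 3)%N (2 * i + 3)%N].
Proof.
split.
- exact: Gamma'_respects_embedding.
- exact: Gamma'_convex.
- exact: Gamma'_angle_monotone.
- exact: Gamma'_on_grid.
Qed.
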